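(* Let $n\in\mathbb{N}$, $r\in\mathbb{N}$, and let $\bm a=(a_1,\dots,a_r)$ and $\bm b=(b_1,\dots,b_r)$ be partitions of $n$ with $r$ parts such that $\bm b\succ\bm a$. Then for every integer $k\ge 3$, \[ p_k(\bm b)>p_k(\bm a). \]
   Context: A partition of $n$ with $r$ parts is an $r$-tuple $(n_1,\dots,n_r)\in\mathbb{N}^r$ with $1\le n_1\le n_2\le\cdots\le n_r$ and $\sum_j n_j=n$. For $k\in\mathbb{N}$, $p_k(m)$ denotes the number of $k$-coloured partitions of $m$, i.e. $\sum_{m\ge0}p_k(m)q^m=\prod_{j\ge1}(1-q^j)^{-k}$, and for a tuple $\bm a=(a_1,\dots,a_r)$ one sets $p_k(\bm a):=p_k(a_1)p_k(a_2)\cdots p_k(a_r)$. For partitions $\bm a,\bm b$ of $n$ with $r$ parts, $\bm b$ majorizes $\bm a$, written $\bm b\succeq\bm a$, if $\sum_{j=1}^{\nu}a_j\le\sum_{j=1}^{\nu}b_j$ for all $\nu\in\{1,\dots,r-1\}$; one writes $\bm b\succ\bm a$ if $\bm b\succeq\bm a$ and $\bm a\neq\bm b$. *)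

(* Defs.v *)
From HB Require Import structures.
From mathcomp Require Import all_boot all_order all_algebra.

Set Implicit Arguments.
Unset Strict Implicit.
Unset Printing Implicit Defensive.

Import GRing.Theory.

(* A k-coloured partition of m is encoded by its multiplicities: [f (j, c)] is
   the number of parts of size [j.+1] and colour [c].  Part sizes and
   multiplicities never exceed m, so the bounds on the indices and on the
   values lose nothing. *)
Definition colored_partitions (k m : nat) : {set {ffun 'I_m * 'I_k -> 'I_m.+1}} :=
  [set f : {ffun 'I_m * 'I_k -> 'I_m.+1} | \sum_(x : 'I_m * 'I_k) x.1.+1 * f x == m].

Definition pk (k m : nat) : nat := #|colored_partitions k m|.

Definition pk_tuple (k r : nat) (a : r.-tuple nat) : nat :=
  \prod_(j < r) pk k (tnth a j).

Definition is_partition (n r : nat) (a : r.-tuple nat) : Prop :=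
  [/\ forall j : 'I_r, 1 <= tnth a j,
      forall i j : 'I_r, i <= j -> tnth a i <= tnth a j
    & \sum_(j < r) tnth a j = n].

(* [majorizes b a] is b >= a.  As the parts increase, the tuple with the larger
   initial sums is the more balanced one, contrary to the usual convention for
   decreasingly ordered tuples. *)
Definition majorizes (r : nat) (b a : r.-tuple nat) : Prop :=
  forall nu : nat, 1 <= nu <= r.-1 ->
    \sum_(j < r | j < nu) tnth a j <= \sum_(j < r | j < nu) tnth b j.

Definition strictly_majorizes (r : nat) (b a : r.-tuple nat) : Prop :=
  majorizes b a /\ a <> b.

Section GeneratingFunction.
Local Open Scope ring_scope.

Local Definition eqX n (p q : {poly int}) := forall i, (i < n)%N -> p`_i = q`_i.

Local Lemma eqXM n p p' q q' : eqX n p p' -> eqX n q q' -> eqX n (p * q) (p' * q').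
Proof.
move=> hp hq i hi; rewrite !coefM; apply: eq_bigr => j _.
rewrite hp ?hq //; first by apply: leq_ltn_trans hi; apply: leq_subr.
by apply: leq_trans hi; apply: ltn_ord.
Qed.

Local Lemma eqXX n p q k : eqX n p q -> eqX n (p ^+ k) (q ^+ k).
Proof. by move=> h; elim: k => [|k IH] //; rewrite !exprS; apply: eqXM. Qed.

Local Lemma eqX_prod n (I : finType) (p q : I -> {poly int}) :
  (forall i, eqX n (p i) (q i)) -> eqX n (\prod_i p i) (\prod_i q i).
Proof.
move=> h; apply: (big_ind2 (eqX n)) => //.
by move=> *; apply: eqXM.
Qed.

Local Definition geo N j : {poly int} := \sum_(i < N.+1) 'X^(j.+1 * i).

Local Lemma geoE N j : (1 - 'X^(j.+1)) * geo N j = 1 - 'X^(j.+1 * N.+1).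
Proof.
rewrite -[RHS]opprB exprM subrX1 -mulNr opprB; congr (_ * _).
by apply: eq_bigr => i _; rewrite exprM.
Qed.

Local Lemma geo_trunc N m j : (m <= N)%N -> eqX m.+1 (geo N j) (geo m j).
Proof.
move=> le_mN i hi; rewrite /geo -!(big_mkord xpredT (fun i => 'X^(j.+1 * i))).
rewrite (big_cat_nat (n := m.+1)) //= coefD [X in _ + X]coef_sum.
rewrite [X in _ + X]big_nat [X in _ + X]big1 ?addr0 // => l /andP[hl _].
rewrite coefXn; case: eqP => // e; move: hi; rewrite e ltnNge.
by rewrite (leq_trans hl) // leq_pmull.
Qed.

Local Lemma geo1 N m j : (m <= j)%N -> eqX m.+1 (geo N j) 1.
Proof.
move=> le_mj i hi; rewrite /geo big_ord_recl muln0 expr0 coefD coef_sum.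
rewrite big1 ?addr0 // => l _; rewrite coefXn; case: eqP => // e.
by move: hi; rewrite e ltnNge lift0 (leq_trans _ (leq_pmulr _ _)).
Qed.

Local Lemma pk_coef k m : (pk k m)%:R = (\prod_(j < m) geo m j ^+ k)`_m :> int.
Proof.
have -> : \prod_(j < m) geo m j ^+ k =
  \prod_(x : 'I_m * 'I_k) \sum_(i < m.+1) 'X^(x.1.+1 * i).
  rewrite -(pair_bigA _ (fun (j : 'I_m) (c : 'I_k) => geo m j)) /=.
  by apply: eq_bigr => j _; rewrite prodr_const card_ord.
rewrite bigA_distr_bigA coef_sum /pk -sum1_card.
rewrite natr_sum big_mkcond; apply: eq_bigr => f _.
by rewrite -expr_sum coefXn eq_sym inE; case: (_ == _).
Qed.

Local Lemma pk_coef_le k m N : (m <= N)%N ->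
  (pk k m)%:R = (\prod_(j < N) geo N j ^+ k)`_m :> int.
Proof.
move=> le_mN; rewrite pk_coef.
have h : eqX m.+1 (\prod_(j < N) geo N j ^+ k)
                  (\prod_(j < N) (if (j < m)%N then geo m j ^+ k else 1)).
  apply: eqX_prod => j; case: ltnP => hj; first exact/eqXX/geo_trunc.
  by rewrite -[X in eqX _ _ X](expr1n _ k); apply/eqXX/geo1.
rewrite h // -big_mkcond /=.
by rewrite (big_ord_widen N (fun j => geo m j ^+ k) le_mN).
Qed.

(* The product formula: as power series,
   (\sum_m p_k(m) q^m) * \prod_(j >= 1) (1 - q^j)^k = 1, stated modulo
   q^(N+1) for every N, so that only factors with j <= N matter. *)
Lemma pk_generating_function (k N i : nat) : (i <= N)%N ->
  ((\sum_(m < N.+1) (pk k m)%:R *: 'X^m)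
     * \prod_(j < N) (1 - 'X^(j.+1)) ^+ k : {poly int})`_i = (i == 0%N)%:R.
Proof.
move=> le_iN; rewrite -coef1.
have h1 : eqX N.+1 (\sum_(m < N.+1) (pk k m)%:R *: 'X^m)
                   (\prod_(j < N) geo N j ^+ k).
  move=> m hm; rewrite -(poly_def N.+1 (fun m => (pk k m)%:R)) coef_poly hm.
  exact: pk_coef_le.
rewrite (eqXM h1 (fun _ _ => erefl)) // -big_split /=.
suff h2 : eqX N.+1 (\prod_(j < N) (geo N j ^+ k * (1 - 'X^(j.+1)) ^+ k))
                        (\prod_(j < N) 1).
  by rewrite h2 // big1.
apply: eqX_prod => j; rewrite -exprMn [geo N j * _]mulrC geoE.
rewrite -[X in eqX _ _ X](expr1n _ k); apply: eqXX => l hl.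
rewrite coefB coefXn; case: eqP => [e|]; last by rewrite subr0.
by move: hl; rewrite e ltnNge leq_pmull.
Qed.

End GeneratingFunction.

(* Main.v *)
Require Import Defs.
From Stdlib Require Import Reals Lra Lia List ZArith Psatz.
From Coquelicot Require Import Coquelicot.

(* It suffices to show that the sequence p_k is strictly log-concave from 2 on;
   the theorem is then Karamata's inequality for log p_k.  Log-concavity passes
   from k and l to k + l, because p_(k+l) is the convolution of p_k and p_l, so
   only k = 3, 4, 5 are needed.  For these, n < 1410 is a computation.

   For n >= 282 k, write the generating function as exp (sum w_f q^f), pick
   r = exp (- t) such that sum f w_f r^f = n (the saddle point), and show
   2 p_k(n) > r p_k(n+1) + p_k(n-1) / r, which gives the claim by AM-GM.  Up to a
   positive factor the difference of the two sides is the integral over [0, pi] of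
     exp (- V x) cos (X x) (1 - cos x),
   V x = sum w_f r^f (1 - cos (f x)),  X x = sum w_f r^f (sin (f x) - f x).
   With 1 - cos y <= y^2/2 and |sin y - y| <= y^3/6 the positive contribution near
   0 is explicit, and keeping in V only one weight 1 for each f bounds the rest. *)

Local Open Scope R_scope.

(** * Finite sums *)

(** The range of log-concavity is forced: $p_k(0)p_k(2) \le p_k(1)^2$ amounts to $k \ge 3$, with
    equality for $k = 3$, so strictness can start only at index 2. As all parts are at least 1,
    Karamata's inequality asks for no more. Every $k \ge 6$ is $3 + (k-3)$ with both summands at
    least 3, whence the base cases 3, 4, 5. The exponent is truncated to finitely many terms, so
    that all integrands are smooth on a compact interval. The integrals are tied to $p_k$ by a
    recurrence: the logarithmic derivative gives the same one for the Fourier coefficients and for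
    $r^j p_k(j)$, and the initial values agree up to the factor $\pi$. The choice of $r$ cancels the
    linear term of the phase, leaving $X = O(x^3)$. Taking the second difference under the integral
    replaces asymptotics of the single $p_k(n)$ by the sign of one integral; its numerical margin
    has to survive down to $n = 282k$, because everything below is computed. *)

Fixpoint lsum {A : Type} (l : list A) (g : A -> R) : R :=
  match l with nil => 0 | x :: l' => g x + lsum l' g end.

Lemma lsum_ext {A} (l : list A) (g h : A -> R) :
  (forall x, In x l -> g x = h x) -> lsum l g = lsum l h.
Proof.
  induction l as [|a l IH]; simpl; intros H; [reflexivity|].
  rewrite (H a) by auto. rewrite IH by auto. reflexivity.
Qed.

Lemma lsum_le {A} (l : list A) (g h : A -> R) :
  (forall x, In x l -> g x <= h x) -> lsum l g <= lsum l h.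
Proof.
  induction l as [|a l IH]; simpl; intros H; [lra|].
  apply Rplus_le_compat; auto.
Qed.

Lemma lsum_plus {A} (l : list A) (g h : A -> R) :
  lsum l (fun x => g x + h x) = lsum l g + lsum l h.
Proof. induction l as [|a l IH]; simpl; [ring|rewrite IH; ring]. Qed.

Lemma lsum_scal {A} (l : list A) (c : R) (g : A -> R) :
  lsum l (fun x => c * g x) = c * lsum l g.
Proof. induction l as [|a l IH]; simpl; [ring|rewrite IH; ring]. Qed.

Lemma lsum_const0 {A} (l : list A) : lsum l (fun _ => 0) = 0.
Proof. induction l as [|a l IH]; simpl; [ring|rewrite IH; ring]. Qed.

Lemma lsum_ge0 {A} (l : list A) (g : A -> R) :
  (forall x, In x l -> 0 <= g x) -> 0 <= lsum l g.
Proof. intros H. rewrite <- (lsum_const0 l). now apply lsum_le. Qed.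

Lemma lsum_abs {A} (l : list A) (g : A -> R) :
  Rabs (lsum l g) <= lsum l (fun x => Rabs (g x)).
Proof.
  induction l as [|a l IH]; simpl; [rewrite Rabs_R0; lra|].
  eapply Rle_trans; [apply Rabs_triang|]. lra.
Qed.

Lemma lsum_app {A} (l m : list A) (g : A -> R) :
  lsum (l ++ m) g = lsum l g + lsum m g.
Proof. induction l as [|a l IH]; simpl; [ring|rewrite IH; ring]. Qed.

Lemma lsum_map {A B} (h : A -> B) (l : list A) (g : B -> R) :
  lsum (map h l) g = lsum l (fun x => g (h x)).
Proof. induction l as [|a l IH]; simpl; [reflexivity|now rewrite IH]. Qed.

Lemma lsum_list_prod {A B} (l : list A) (m : list B) (g : A * B -> R) :
  lsum (list_prod l m) g = lsum l (fun a => lsum m (fun b => g (a, b))).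
Proof.
  induction l as [|a l IH]; simpl; [reflexivity|].
  now rewrite lsum_app, lsum_map, IH.
Qed.

Lemma is_derive_lsum {A} (l : list A) (g : A -> R -> R) (dg : A -> R) (x : R) :
  (forall i, is_derive (g i) x (dg i)) ->
  is_derive (fun y => lsum l (fun i => g i y)) x (lsum l dg).
Proof.
  intros H; induction l as [|a l IH]; simpl.
  - apply (is_derive_const 0 x).
  - apply (is_derive_plus (g a) _ x); auto.
Qed.

Lemma is_RInt_lsum {A} (l : list A) (g : A -> R -> R) (v : A -> R) (a b : R) :
  (forall i, is_RInt (g i) a b (v i)) ->
  is_RInt (fun y => lsum l (fun i => g i y)) a b (lsum l v).
Proof.
  intros H; induction l as [|i l IH]; simpl.
  - pose proof (is_RInt_const (V := R_NormedModule) a b 0) as H0.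
    rewrite (scal_zero_r (V := R_NormedModule)) in H0. exact H0.
  - apply (is_RInt_plus (g i) _ a b); auto.
Qed.

(** * Fourier coefficients of the exponential of a trigonometric polynomial *)

Definition re_poly {A} (l : list A) (w : A -> R) (f : A -> nat) (th : R) : R :=
  lsum l (fun i => w i * cos (INR (f i) * th)).

Definition im_poly {A} (l : list A) (w : A -> R) (f : A -> nat) (th : R) : R :=
  lsum l (fun i => w i * sin (INR (f i) * th)).

(** With $P(q) = \sum_i w_i q^{f_i}$, this is the real part of $\exp(P(e^{i\theta}))\,
    e^{-ij\theta}$. *)
Definition mode {A} (l : list A) (w : A -> R) (f : A -> nat) (j : Z) (th : R) : R :=
  exp (re_poly l w f th) * cos (im_poly l w f th - IZR j * th).

(** The weights are real, so the integrand is even and half a period suffices: the value is $\pi$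
    times the coefficient of $q^j$ in $\exp P$. *)
Definition fourier {A} (l : list A) (w : A -> R) (f : A -> nat) (j : Z) : R :=
  RInt (mode l w f j) 0 PI.

Lemma is_derive_re_poly {A} (l : list A) w f th :
  is_derive (re_poly l w f) th
    (- lsum l (fun i => INR (f i) * w i * sin (INR (f i) * th))).
Proof.
  replace (- _) with (lsum l (fun i => - (INR (f i) * w i * sin (INR (f i) * th)))).
  - apply (is_derive_lsum l (fun i y => w i * cos (INR (f i) * y))). intros i.
    auto_derive; auto; ring.
  - transitivity (lsum l (fun i => -1 * (INR (f i) * w i * sin (INR (f i) * th))));
      [|rewrite lsum_scal; ring].
    apply lsum_ext; intros; ring.
Qed.

Lemma is_derive_im_poly {A} (l : list A) w f th :
  is_derive (im_poly l w f) th
    (lsum l (fun i => INR (f i) * w i * cos (INR (f i) * th))).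
Proof.
  apply (is_derive_lsum l (fun i y => w i * sin (INR (f i) * y))). intros i.
  auto_derive; auto; ring.
Qed.

Lemma is_derive_mode {A} (l : list A) w f j th :
  ex_derive (mode l w f j) th.
Proof.
  unfold mode. auto_derive.
  split; [|split; [|auto]].
  - eexists; apply is_derive_re_poly.
  - eexists; apply is_derive_im_poly.
Qed.

Lemma ex_RInt_mode {A} (l : list A) w f j a b : ex_RInt (mode l w f j) a b.
Proof.
  apply (@ex_RInt_continuous R_CompleteNormedModule). intros z _.
  apply (@ex_derive_continuous R_AbsRing R_NormedModule), is_derive_mode.
Qed.

(** Lowering the index by [f i] adds [f i * th] to the phase, and the addition formula produces the
    derivatives of [re_poly] and [im_poly]. The summation list [m] is kept apart from [l] so that
    the induction leaves the exponent fixed. *)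
Lemma lsum_mode {A} (l : list A) w f m j th :
  lsum m (fun i => INR (f i) * w i * mode l w f (j - Z.of_nat (f i)) th) =
  exp (re_poly l w f th) *
  (cos (im_poly l w f th - IZR j * th)
     * lsum m (fun i => INR (f i) * w i * cos (INR (f i) * th))
   - sin (im_poly l w f th - IZR j * th)
     * lsum m (fun i => INR (f i) * w i * sin (INR (f i) * th))).
Proof.
  induction m as [|a m IH]; simpl; [ring|]. rewrite IH. unfold mode at 1.
  rewrite minus_IZR, <- INR_IZR_INZ.
  replace (im_poly l w f th - (IZR j - INR (f a)) * th) with
    ((im_poly l w f th - IZR j * th) + INR (f a) * th) by ring.
  rewrite cos_plus. ring.
Qed.

Lemma sin_IZR_PI (j : Z) : sin (IZR j * PI) = 0.
Proof. apply sin_eq_0_1. now exists j. Qed.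

(* The integrand is, up to sign, the derivative of
   [exp (re_poly th) * sin (im_poly th - j th)], which vanishes at 0 and PI. *)
Lemma fourier_recurrence {A} (l : list A) w f j :
  lsum l (fun i => INR (f i) * w i * fourier l w f (j - Z.of_nat (f i))) =
  IZR j * fourier l w f j.
Proof.
  set (df := fun th =>
    lsum l (fun i => INR (f i) * w i * mode l w f (j - Z.of_nat (f i)) th)
    - IZR j * mode l w f j th).
  assert (Hint : is_RInt df 0 PI
    (lsum l (fun i => INR (f i) * w i * fourier l w f (j - Z.of_nat (f i)))
     - IZR j * fourier l w f j)).
  { apply (is_RInt_minus (V := R_NormedModule)).
    - apply (is_RInt_lsum l (fun i th => INR (f i) * w i * mode l w f (j - Z.of_nat (f i)) th)).
      intros i. apply (is_RInt_scal (V := R_NormedModule) (mode _ _ _ _)).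
      apply (RInt_correct (V := R_CompleteNormedModule)), ex_RInt_mode.
    - apply (is_RInt_scal (V := R_NormedModule) (mode _ _ _ _)).
      apply (RInt_correct (V := R_CompleteNormedModule)), ex_RInt_mode. }
  set (F := fun th => exp (re_poly l w f th) * sin (im_poly l w f th - IZR j * th)).
  assert (Hder : is_RInt df 0 PI (minus (F PI) (F 0))).
  { apply (is_RInt_derive F df).
    - intros th _. unfold F, df. rewrite lsum_mode. unfold mode.
      auto_derive.
      + split; [|split; [|auto]];
          [eexists; apply is_derive_re_poly|eexists; apply is_derive_im_poly].
      + replace (Derive (fun x : R => re_poly l w f x) th) with
          (- lsum l (fun i => INR (f i) * w i * sin (INR (f i) * th)))
          by (symmetry; apply is_derive_unique, is_derive_re_poly).
        replace (Derive (fun x : R => im_poly l w f x) th) with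
          (lsum l (fun i => INR (f i) * w i * cos (INR (f i) * th)))
          by (symmetry; apply is_derive_unique, is_derive_im_poly).
        unfold Rminus; ring.
    - intros th _. apply (@ex_derive_continuous R_AbsRing R_NormedModule).
      unfold df. apply (ex_derive_minus (V := R_NormedModule)).
      + eexists. apply (is_derive_lsum l
          (fun i th => INR (f i) * w i * mode l w f (j - Z.of_nat (f i)) th)).
        intros i. apply (is_derive_scal (mode l w f (j - Z.of_nat (f i)))).
        apply Derive_correct, is_derive_mode.
      + eexists. apply (is_derive_scal (mode l w f j)).
        apply Derive_correct, is_derive_mode. }
  assert (F0 : F 0 = 0).
  { unfold F, im_poly. rewrite (lsum_ext _ _ (fun _ => 0)).
    - rewrite lsum_const0, Rmult_0_r, Rminus_0_r, sin_0. ring.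
    - intros i _. rewrite Rmult_0_r, sin_0. ring. }
  assert (FPI : F PI = 0).
  { unfold F, im_poly. rewrite (lsum_ext _ _ (fun _ => 0)).
    - rewrite lsum_const0. replace (0 - IZR j * PI) with (- (IZR j * PI)) by ring.
      rewrite sin_neg, sin_IZR_PI. ring.
    - intros i _. rewrite INR_IZR_INZ, sin_IZR_PI. ring. }
  rewrite F0, FPI in Hder.
  pose proof (is_RInt_unique _ _ _ _ Hint) as E1.
  pose proof (is_RInt_unique _ _ _ _ Hder) as E2.
  rewrite E1 in E2. unfold minus, plus, opp in E2. simpl in E2. lra.
Qed.

Lemma fourier_bound {A} (l : list A) w f j :
  Rabs (fourier l w f j) <= PI * exp (lsum l (fun i => Rabs (w i))).
Proof.
  replace PI with (PI - 0) by ring. unfold fourier.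
  pose proof PI_RGT_0.
  apply abs_RInt_le_const; [lra|apply ex_RInt_mode|].
  intros th _. unfold mode. rewrite Rabs_mult, (Rabs_pos_eq (exp _)) by (left; apply exp_pos).
  rewrite <- (Rmult_1_r (exp (lsum _ _))).
  apply Rmult_le_compat; try apply Rabs_pos; [left; apply exp_pos| |].
  - assert (He : re_poly l w f th <= lsum l (fun i => Rabs (w i))).
    { apply lsum_le. intros i _. eapply Rle_trans; [apply Rle_abs|].
      rewrite Rabs_mult. rewrite <- (Rmult_1_r (Rabs (w i))) at 2.
      apply Rmult_le_compat_l; [apply Rabs_pos|]. apply Rabs_le, COS_bound. }
    destruct He as [He|He]; [left; now apply exp_increasing|rewrite He; apply Rle_refl].
  - apply Rabs_le, COS_bound.
Qed.

(* Far from the origin the recurrence halves the bound at each use, so the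
   coefficients of very negative index vanish; the recurrence then propagates
   the vanishing up to -1. *)
Lemma fourier_neg {A} (l : list A) w f (j : Z) :
  (forall i, In i l -> (1 <= f i)%nat) -> (j < 0)%Z -> fourier l w f j = 0.
Proof.
  intros Hf.
  set (B := PI * exp (lsum l (fun i => Rabs (w i)))).
  set (C := lsum l (fun i => INR (f i) * Rabs (w i))).
  assert (HB : 0 < B) by (apply Rmult_lt_0_compat; [apply PI_RGT_0|apply exp_pos]).
  assert (rec : forall m : nat, INR m * fourier l w f (- Z.of_nat m) =
    - lsum l (fun i => INR (f i) * w i * fourier l w f (- Z.of_nat (m + f i)))).
  { intros m. pose proof (fourier_recurrence l w f (- Z.of_nat m)) as E.
    rewrite opp_IZR, <- INR_IZR_INZ in E.
    rewrite (lsum_ext _ _ (fun i => INR (f i) * w i * fourier l w f (- Z.of_nat m - Z.of_nat (f i)))).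
    - lra.
    - intros i _. repeat f_equal. lia. }
  destruct (nfloor_ex (Rmax 0 (2 * C))) as [m0 [_ Hm0]]; [apply Rmax_l|].
  assert (Hm0' : 2 * C < INR (S m0)).
  { rewrite S_INR. pose proof (Rmax_r 0 (2 * C)). lra. }
  assert (dec : forall q m, (S m0 <= m)%nat ->
    Rabs (fourier l w f (- Z.of_nat m)) <= B * (1 / 2) ^ q).
  { induction q as [|q IH]; intros m Hm.
    - simpl. rewrite Rmult_1_r. apply fourier_bound.
    - assert (Hm' : 2 * C < INR m) by (apply le_INR in Hm; lra).
      assert (H : INR m * Rabs (fourier l w f (- Z.of_nat m)) <= C * (B * (1 / 2) ^ q)).
      { rewrite <- (Rabs_pos_eq (INR m)) at 1 by apply pos_INR.
        rewrite <- Rabs_mult, rec, Rabs_Ropp.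
        eapply Rle_trans; [apply lsum_abs|].
        unfold C. rewrite Rmult_comm, <- lsum_scal. apply lsum_le. intros i Hi.
        rewrite !Rabs_mult, (Rabs_pos_eq (INR (f i))) by apply pos_INR.
        rewrite (Rmult_comm (B * _)).
        apply Rmult_le_compat_l.
        - apply Rmult_le_pos; [apply pos_INR|apply Rabs_pos].
        - apply IH. lia. }
      assert (Hp : 0 <= B * (1 / 2) ^ q).
      { apply Rmult_le_pos; [lra|apply pow_le; lra]. }
      assert (0 < INR m).
      { apply lt_0_INR. lia. }
      apply Rmult_le_reg_l with (INR m); [lra|].
      eapply Rle_trans; [exact H|]. simpl. nra. }
  assert (zero : forall p m, (1 <= m)%nat -> (S m0 <= m + p)%nat ->
    fourier l w f (- Z.of_nat m) = 0).
  { induction p as [|p IH]; intros m Hm Hmp.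
    - destruct (Req_dec (fourier l w f (- Z.of_nat m)) 0) as [E|E]; [exact E|exfalso].
      apply Rabs_pos_lt in E.
      destruct (pow_lt_1_zero (1 / 2)) with
        (y := Rabs (fourier l w f (- Z.of_nat m)) / B) as [N HN].
      + rewrite Rabs_pos_eq; lra.
      + now apply Rdiv_lt_0_compat.
      + specialize (HN N (le_n _)). rewrite Rabs_pos_eq in HN by (apply pow_le; lra).
        specialize (dec N m). apply (Rmult_lt_compat_l B) in HN; [|lra].
        replace (B * (Rabs (fourier l w f (- Z.of_nat m)) / B)) with
          (Rabs (fourier l w f (- Z.of_nat m))) in HN by (field; lra).
        assert (S m0 <= m)%nat by lia. specialize (dec H). lra.
    - apply Rmult_eq_reg_l with (INR m).
      + rewrite rec, (lsum_ext _ _ (fun _ => 0)).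
        * rewrite lsum_const0. ring.
        * intros i Hi. specialize (Hf i Hi). rewrite IH by lia. ring.
      + apply not_0_INR. lia. }
  intros Hj. replace j with (- Z.of_nat (Z.to_nat (- j)))%Z by lia.
  apply (zero (S m0)); lia.
Qed.

Lemma re_poly_scal {A} (l : list A) w f c th :
  re_poly l (fun i => c * w i) f th = c * re_poly l w f th.
Proof. unfold re_poly. rewrite <- lsum_scal. apply lsum_ext; intros; ring. Qed.

Lemma im_poly_scal {A} (l : list A) w f c th :
  im_poly l (fun i => c * w i) f th = c * im_poly l w f th.
Proof. unfold im_poly. rewrite <- lsum_scal. apply lsum_ext; intros; ring. Qed.

Lemma continuity_pt_re_poly {A} (l : list A) w f th : continuity_pt (re_poly l w f) th.
Proof.
  apply continuity_pt_filterlim, (@ex_derive_continuous R_AbsRing R_NormedModule).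
  eexists; apply is_derive_re_poly.
Qed.

Lemma continuity_pt_im_poly {A} (l : list A) w f th : continuity_pt (im_poly l w f) th.
Proof.
  apply continuity_pt_filterlim, (@ex_derive_continuous R_AbsRing R_NormedModule).
  eexists; apply is_derive_im_poly.
Qed.

(* Scaling all weights by [c] and differentiating in [c] gives a combination of
   the coefficients of negative index, so the mean does not depend on [c]. *)
Lemma fourier_0 {A} (l : list A) w f :
  (forall i, In i l -> (1 <= f i)%nat) -> fourier l w f 0 = PI.
Proof.
  intros Hf.
  set (g := fun c th : R => exp (c * re_poly l w f th) * cos (c * im_poly l w f th)).
  assert (Hg : forall c th, g c th = mode l (fun i => c * w i) f 0 th).
  { intros c th. unfold g, mode. rewrite re_poly_scal, im_poly_scal.
    f_equal. f_equal. ring. }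
  set (dg := fun c th => re_poly l w f th * exp (c * re_poly l w f th) * cos (c * im_poly l w f th)
    + - (im_poly l w f th * exp (c * re_poly l w f th) * sin (c * im_poly l w f th))).
  assert (Hdg : forall c th, is_derive (fun u => g u th) c (dg c th)).
  { intros c th. unfold g, dg. auto_derive; [auto|]. ring. }
  assert (Hdg0 : forall c, RInt (dg c) 0 PI = 0).
  { intros c.
    pose proof (is_RInt_lsum l (fun i th => w i * mode l (fun i => c * w i) f (0 - Z.of_nat (f i)) th)
      (fun i => w i * fourier l (fun i => c * w i) f (0 - Z.of_nat (f i))) 0 PI) as H.
    rewrite (lsum_ext _ (fun i => w i * fourier _ _ _ _) (fun _ => 0)), lsum_const0 in H.
    2:{ intros i Hi. rewrite fourier_neg; [ring|exact Hf|]. specialize (Hf i Hi). lia. }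
    apply is_RInt_unique. eapply is_RInt_ext; [|apply H].
    - intros th _. cbn beta.
      rewrite (lsum_ext _ _ (fun i => w i * (exp (c * re_poly l w f th) *
          cos (c * im_poly l w f th - IZR (0 - Z.of_nat (f i)) * th))))
        by (intros i _; unfold mode; now rewrite re_poly_scal, im_poly_scal).
      assert (E : forall m, lsum m (fun i => w i * (exp (c * re_poly l w f th) *
          cos (c * im_poly l w f th - IZR (0 - Z.of_nat (f i)) * th))) =
        exp (c * re_poly l w f th) *
          (cos (c * im_poly l w f th) * lsum m (fun i => w i * cos (INR (f i) * th))
           - sin (c * im_poly l w f th) * lsum m (fun i => w i * sin (INR (f i) * th)))).
      { induction m as [|a m IH]; cbn [lsum]; [ring|]. rewrite IH.
        replace (c * im_poly l w f th - IZR (0 - Z.of_nat (f a)) * th) with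
          (c * im_poly l w f th + INR (f a) * th)
          by (rewrite minus_IZR, <- INR_IZR_INZ; ring).
        rewrite cos_plus. ring. }
      rewrite E. fold (re_poly l w f th) (im_poly l w f th).
      unfold dg. match goal with |- ?a = ?b => change (@eq R a b) end. ring.
    - intros i. apply (is_RInt_scal (V := R_NormedModule) (mode _ _ _ _)).
      apply (RInt_correct (V := R_CompleteNormedModule)), ex_RInt_mode. }
  assert (HI : forall c, is_derive (fun c => RInt (fun th => g c th) 0 PI) c 0).
  { intros c.
    assert (E : RInt (fun t => Derive (fun u => g u t) c) 0 PI = 0).
    { transitivity (RInt (dg c) 0 PI); [|apply Hdg0].
      apply RInt_ext. intros th _. apply is_derive_unique, Hdg. }
    pose proof (is_derive_RInt_param g 0 PI c) as D. rewrite E in D. apply D.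
    - apply filter_forall. intros x th _. eexists; apply Hdg.
    - intros th _. apply continuity_2d_pt_ext with dg.
      { intros x y. symmetry. apply is_derive_unique, Hdg. }
      assert (Hre : continuity_2d_pt (fun _ v => re_poly l w f v) c th).
      { apply (continuity_1d_2d_pt_comp (re_poly l w f) (fun _ v => v));
          [apply continuity_pt_re_poly|apply continuity_2d_pt_id2]. }
      assert (Him : continuity_2d_pt (fun _ v => im_poly l w f v) c th).
      { apply (continuity_1d_2d_pt_comp (im_poly l w f) (fun _ v => v));
          [apply continuity_pt_im_poly|apply continuity_2d_pt_id2]. }
      assert (Hexp : continuity_2d_pt (fun u v => exp (u * re_poly l w f v)) c th).
      { apply (continuity_1d_2d_pt_comp exp (fun u v => u * re_poly l w f v)).
        - apply derivable_continuous_pt, derivable_pt_exp.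
        - apply continuity_2d_pt_mult; [apply continuity_2d_pt_id1|exact Hre]. }
      assert (Harg : continuity_2d_pt (fun u v => u * im_poly l w f v) c th).
      { apply continuity_2d_pt_mult; [apply continuity_2d_pt_id1|exact Him]. }
      unfold dg. apply continuity_2d_pt_plus; [|apply continuity_2d_pt_opp].
      + apply continuity_2d_pt_mult; [apply continuity_2d_pt_mult; assumption|].
        apply (continuity_1d_2d_pt_comp cos (fun u v => u * im_poly l w f v)); [|assumption].
        apply continuity_cos.
      + apply continuity_2d_pt_mult; [apply continuity_2d_pt_mult; assumption|].
        apply (continuity_1d_2d_pt_comp sin (fun u v => u * im_poly l w f v)); [|assumption].
        apply continuity_sin.
    - apply filter_forall. intros x. eapply ex_RInt_ext; [|apply (ex_RInt_mode l (fun i => x * w i) f 0)].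
      intros th _. symmetry. apply Hg. }
  assert (E1 : fourier l w f 0 = RInt (fun th => g 1 th) 0 PI).
  { apply RInt_ext. intros th _. unfold g, mode. rewrite !Rmult_1_l, Rmult_0_l, Rminus_0_r. reflexivity. }
  assert (E0 : RInt (fun th => g 0 th) 0 PI = PI).
  { rewrite (RInt_ext _ (fun _ => 1)).
    - rewrite RInt_const. unfold scal; simpl; unfold mult; simpl.
      match goal with |- ?a = ?b => change (@eq R a b) end. ring.
    - intros th _. unfold g. rewrite !Rmult_0_l, exp_0, cos_0. lra. }
  rewrite E1. transitivity (RInt (fun th => g 0 th) 0 PI); [|exact E0].
  destruct (MVT_gen (fun c => RInt (fun th => g c th) 0 PI) 0 1 (fun _ => 0)) as [c [_ Hc]].
  - intros x _. exact (HI x).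
  - intros x _. apply continuity_pt_filterlim.
    apply (ex_derive_continuous (fun c : R => RInt (fun th : R => g c th) 0 PI) x).
    exists 0. exact (HI x).
  - lra.
Qed.

(** * Elementary inequalities *)

(** Source of the Taylor bounds below: applied to the difference of two sides, it integrates an
    inequality already known for the derivatives. *)
Lemma le_of_derive_nonneg (f df : R -> R) (x : R) :
  (forall y, is_derive f y (df y)) -> (forall y, 0 <= y -> 0 <= df y) ->
  0 <= x -> f 0 <= f x.
Proof.
  intros Hf Hdf Hx.
  destruct (MVT_gen f 0 x df) as [c [Hc E]].
  - intros y _. apply Hf.
  - intros y _. apply continuity_pt_filterlim.
    apply (ex_derive_continuous f y). exists (df y). apply Hf.
  - rewrite Rmin_left, Rmax_right in Hc by lra.
    assert (0 <= df c) by (apply Hdf; lra). nra.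
Qed.

Lemma sin_le_id x : 0 <= x -> sin x <= x.
Proof.
  intros Hx.
  assert (0 - sin 0 <= x - sin x); [|rewrite sin_0 in *; lra].
  apply (le_of_derive_nonneg (fun x => x - sin x) (fun x => 1 - cos x)); auto.
  - intros y. auto_derive; auto; ring.
  - intros y _. pose proof (COS_bound y). lra.
Qed.

Lemma cos_ge_pos x : 0 <= x -> 1 - x ^ 2 / 2 <= cos x.
Proof.
  intros Hx.
  assert (cos 0 - 1 + 0 ^ 2 / 2 <= cos x - 1 + x ^ 2 / 2); [|rewrite cos_0 in *; lra].
  apply (le_of_derive_nonneg (fun x => cos x - 1 + x ^ 2 / 2) (fun x => x - sin x)); auto.
  - intros y. auto_derive; auto; simpl; field.
  - intros y Hy. pose proof (sin_le_id y Hy). lra.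
Qed.

Lemma sin_ge_pos x : 0 <= x -> x - x ^ 3 / 6 <= sin x.
Proof.
  intros Hx.
  assert (sin 0 - 0 + 0 ^ 3 / 6 <= sin x - x + x ^ 3 / 6); [|rewrite sin_0 in *; lra].
  apply (le_of_derive_nonneg (fun x => sin x - x + x ^ 3 / 6) (fun x => cos x - 1 + x ^ 2 / 2)); auto.
  - intros y. auto_derive; auto; simpl; field.
  - intros y Hy. pose proof (cos_ge_pos y Hy). lra.
Qed.

Lemma cos_le_pos x : 0 <= x -> cos x <= 1 - x ^ 2 / 2 + x ^ 4 / 24.
Proof.
  intros Hx.
  assert (1 - 0 ^ 2 / 2 + 0 ^ 4 / 24 - cos 0 <= 1 - x ^ 2 / 2 + x ^ 4 / 24 - cos x);
    [|rewrite cos_0 in *; lra].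
  apply (le_of_derive_nonneg (fun x => 1 - x ^ 2 / 2 + x ^ 4 / 24 - cos x)
    (fun x => sin x - x + x ^ 3 / 6)); auto.
  - intros y. auto_derive; auto; simpl; field.
  - intros y Hy. pose proof (sin_ge_pos y Hy). lra.
Qed.

Lemma cos_ge x : 1 - x ^ 2 / 2 <= cos x.
Proof.
  destruct (Rle_dec 0 x) as [H|H]; [now apply cos_ge_pos|].
  rewrite <- cos_neg. replace (x ^ 2) with ((- x) ^ 2) by ring. apply cos_ge_pos. lra.
Qed.

Lemma Rabs_sin_sub_id x : 0 <= x -> Rabs (sin x - x) <= x ^ 3 / 6.
Proof.
  intros Hx. pose proof (sin_le_id x Hx). pose proof (sin_ge_pos x Hx).
  rewrite Rabs_left1; lra.
Qed.

Lemma exp_le x y : x <= y -> exp x <= exp y.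
Proof. intros [H| ->]; [left; now apply exp_increasing|apply Rle_refl]. Qed.

Lemma one_sub_le_exp_neg y : 1 - y <= exp (- y).
Proof. pose proof (exp_ineq1_le (- y)). lra. Qed.

Lemma exp_neg_le_taylor y : 0 <= y -> exp (- y) <= 1 - y + y ^ 2 / 2.
Proof.
  intros Hy.
  assert (1 - 0 + 0 ^ 2 / 2 - exp (- 0) <= 1 - y + y ^ 2 / 2 - exp (- y));
    [|rewrite Ropp_0, exp_0 in *; lra].
  apply (le_of_derive_nonneg (fun y => 1 - y + y ^ 2 / 2 - exp (- y)) (fun y => exp (- y) - 1 + y)); auto.
  - intros z. auto_derive; auto; simpl; field.
  - intros z _. pose proof (one_sub_le_exp_neg z). lra.
Qed.

Lemma exp_neg_ge_taylor y : 0 <= y -> 1 - y + y ^ 2 / 2 - y ^ 3 / 6 <= exp (- y).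
Proof.
  intros Hy.
  assert (exp (- 0) - 1 + 0 - 0 ^ 2 / 2 + 0 ^ 3 / 6 <= exp (- y) - 1 + y - y ^ 2 / 2 + y ^ 3 / 6);
    [|rewrite Ropp_0, exp_0 in *; lra].
  apply (le_of_derive_nonneg (fun y => exp (- y) - 1 + y - y ^ 2 / 2 + y ^ 3 / 6)
    (fun y => 1 - y + y ^ 2 / 2 - exp (- y))); auto.
  - intros z. auto_derive; auto; simpl; field.
  - intros z Hz. pose proof (exp_neg_le_taylor z Hz). lra.
Qed.

(* This is [coth (t / 2) >= 2 / t]. *)
Lemma coth_half_bound t : 0 <= t -> 2 * (1 - exp (- t)) <= t * (1 + exp (- t)).
Proof.
  intros Ht.
  assert (0 * (1 + exp (- 0)) - 2 * (1 - exp (- 0)) <= t * (1 + exp (- t)) - 2 * (1 - exp (- t)));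
    [|rewrite Ropp_0, exp_0 in *; lra].
  apply (le_of_derive_nonneg (fun t => t * (1 + exp (- t)) - 2 * (1 - exp (- t)))
    (fun t => 1 - (1 + t) * exp (- t))); auto.
  - intros z. auto_derive; auto; ring.
  - intros z Hz. pose proof (exp_ineq1_le z). pose proof (exp_pos (- z)).
    assert (exp z * exp (- z) = 1) by (rewrite <- exp_plus, Rplus_opp_r; apply exp_0).
    nra.
Qed.

Lemma exp_ge_taylor7 y : 0 <= y ->
  1 + y + y ^ 2 / 2 + y ^ 3 / 6 + y ^ 4 / 24 + y ^ 5 / 120 + y ^ 6 / 720 + y ^ 7 / 5040 <= exp y.
Proof. intros Hy. pose proof (exp_ge_taylor y 7 Hy). simpl in *. lra. Qed.

Lemma e_ge : 271 / 100 <= exp 1.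
Proof. pose proof (exp_ge_taylor7 1). lra. Qed.

Lemma exp_INR_mul n y : exp (INR n * y) = exp y ^ n.
Proof.
  induction n as [|n IH]; [now rewrite Rmult_0_l, exp_0|].
  rewrite S_INR, Rmult_plus_distr_r, Rmult_1_l, exp_plus, IH. simpl. ring.
Qed.

(* Tangent line bound [exp u >= e u], raised to the power [p]. *)
Lemma exp_neg_le_pow (p : nat) y : (1 <= p)%nat -> 0 < y ->
  exp (- y) <= (INR p / (271 / 100 * y)) ^ p.
Proof.
  intros Hp Hy. assert (Hp' : 0 < INR p) by (apply lt_0_INR; lia).
  replace (exp (- y)) with (exp (- (y / INR p)) ^ p).
  2:{ rewrite <- exp_INR_mul. f_equal. field. lra. }
  apply pow_incr. split; [left; apply exp_pos|].
  assert (Hu : 0 < y / INR p) by now apply Rdiv_lt_0_compat.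
  assert (H : 271 / 100 * (y / INR p) <= exp (y / INR p)).
  { replace (y / INR p) with (1 + (y / INR p - 1)) at 2 by ring.
    rewrite exp_plus. pose proof e_ge. pose proof (exp_ineq1_le (y / INR p - 1)). nra. }
  rewrite exp_Ropp. replace (INR p / (271 / 100 * y)) with (/ (271 / 100 * (y / INR p))).
  - apply Rinv_le_contravar; [nra|exact H].
  - field. lra.
Qed.

(** * Power sums *)

Lemma lsum_seq_S (g : nat -> R) (M : nat) :
  lsum (seq 1 (S M)) g = lsum (seq 1 M) g + g (S M).
Proof. rewrite seq_S, lsum_app. simpl. ring. Qed.

(** The tail beyond [M] has a closed form; adding it turns the bound into an identity that goes
    through by induction. The next two sums are treated alike. *)
Lemma geom_sum1_le x M : 0 < x < 1 ->
  lsum (seq 1 M) (fun e => INR e * x ^ e) <= x / (1 - x) ^ 2.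
Proof.
  intros Hx.
  assert (E : lsum (seq 1 M) (fun e => INR e * x ^ e) + x ^ M *
    (INR M * (x / (1 - x)) + x / (1 - x) ^ 2) = x / (1 - x) ^ 2).
  { induction M as [|M IH]; [simpl; field; lra|].
    rewrite lsum_seq_S. etransitivity; [|exact IH]. rewrite S_INR. simpl. field. lra. }
  enough (0 <= x ^ M * (INR M * (x / (1 - x)) + x / (1 - x) ^ 2)) by lra.
  assert (0 < x / (1 - x)) by (apply Rdiv_lt_0_compat; lra).
  assert (0 < x / (1 - x) ^ 2) by (apply Rdiv_lt_0_compat; [lra|apply pow_lt; lra]).
  pose proof (pos_INR M).
  apply Rmult_le_pos; [apply pow_le; lra|nra].
Qed.

Lemma geom_sum2_le x M : 0 < x < 1 ->
  lsum (seq 1 M) (fun e => INR e ^ 2 * x ^ e) <= x * (1 + x) / (1 - x) ^ 3.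
Proof.
  intros Hx.
  set (t := fun M => x ^ M * (INR M ^ 2 * (x / (1 - x)) + 2 * INR M * (x / (1 - x) ^ 2)
    + x * (1 + x) / (1 - x) ^ 3)).
  assert (E : lsum (seq 1 M) (fun e => INR e ^ 2 * x ^ e) + t M = x * (1 + x) / (1 - x) ^ 3).
  { induction M as [|M IH]; [unfold t; simpl; field; lra|].
    rewrite lsum_seq_S. etransitivity; [|exact IH]. unfold t. rewrite S_INR. simpl. field. lra. }
  enough (0 <= t M) by lra. unfold t.
  assert (0 < x / (1 - x)) by (apply Rdiv_lt_0_compat; lra).
  assert (0 < x / (1 - x) ^ 2) by (apply Rdiv_lt_0_compat; [lra|apply pow_lt; lra]).
  assert (0 < x * (1 + x) / (1 - x) ^ 3)
    by (apply Rdiv_lt_0_compat; [apply Rmult_lt_0_compat; lra|apply pow_lt; lra]).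
  pose proof (pos_INR M). pose proof (pow2_ge_0 (INR M)).
  apply Rmult_le_pos; [apply pow_le; lra|nra].
Qed.

Lemma geom_sum3_le x M : 0 < x < 1 ->
  lsum (seq 1 M) (fun e => INR e ^ 3 * x ^ e) <= x * (1 + 4 * x + x ^ 2) / (1 - x) ^ 4.
Proof.
  intros Hx.
  set (t := fun M => x ^ M * (INR M ^ 3 * (x / (1 - x)) + 3 * INR M ^ 2 * (x / (1 - x) ^ 2)
    + 3 * INR M * (x * (1 + x) / (1 - x) ^ 3) + x * (1 + 4 * x + x ^ 2) / (1 - x) ^ 4)).
  assert (E : lsum (seq 1 M) (fun e => INR e ^ 3 * x ^ e) + t M =
    x * (1 + 4 * x + x ^ 2) / (1 - x) ^ 4).
  { induction M as [|M IH]; [unfold t; simpl; field; lra|].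
    rewrite lsum_seq_S. etransitivity; [|exact IH]. unfold t. rewrite S_INR. simpl. field. lra. }
  enough (0 <= t M) by lra. unfold t.
  assert (0 < x / (1 - x)) by (apply Rdiv_lt_0_compat; lra).
  assert (0 < x / (1 - x) ^ 2) by (apply Rdiv_lt_0_compat; [lra|apply pow_lt; lra]).
  assert (0 < x * (1 + x) / (1 - x) ^ 3)
    by (apply Rdiv_lt_0_compat; [apply Rmult_lt_0_compat; lra|apply pow_lt; lra]).
  assert (0 < x * (1 + 4 * x + x ^ 2) / (1 - x) ^ 4)
    by (apply Rdiv_lt_0_compat; [apply Rmult_lt_0_compat; [lra|pose proof (pow2_ge_0 x); lra]|apply pow_lt; lra]).
  pose proof (pos_INR M). pose proof (pow2_ge_0 (INR M)).
  assert (0 <= INR M ^ 3) by (apply pow_le; lra).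
  apply Rmult_le_pos; [apply pow_le; lra|].
  assert (forall a b, 0 <= a -> 0 < b -> 0 <= a * b) as Hab by (intros; apply Rmult_le_pos; lra).
  repeat apply Rplus_le_le_0_compat; try lra; apply Hab; lra.
Qed.

(** Telescoping with $1/m^2 \le 1/(m-1/2) - 1/(m+1/2)$; the sharper bound $5/3 - 1/(M+1/2)$ is an
    equality at $M = 1$. *)
Lemma lsum_inv_sq_le M : lsum (seq 1 M) (fun d => / INR d ^ 2) <= 5 / 3.
Proof.
  destruct M as [|M]; [simpl; lra|].
  enough (H : lsum (seq 1 (S M)) (fun d => / INR d ^ 2) <= 5 / 3 - / (INR (S M) + 1 / 2)).
  { pose proof (pos_INR (S M)).
    assert (0 < / (INR (S M) + 1 / 2)) by (apply Rinv_0_lt_compat; lra). lra. }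
  induction M as [|M IH]; [simpl; lra|].
  rewrite lsum_seq_S. rewrite (S_INR (S M)). pose proof (pos_INR M).
  rewrite S_INR in *. set (m := INR M) in *.
  assert (/ (m + 1 + 1) ^ 2 <= / (m + 1 + 1 / 2) - / (m + 1 + 1 + 1 / 2)); [|lra].
  replace (/ (m + 1 + 1 / 2) - / (m + 1 + 1 + 1 / 2)) with
    (/ ((m + 1 + 1 / 2) * (m + 1 + 1 + 1 / 2))) by (field; split; lra).
  apply Rinv_le_contravar; nra.
Qed.

(* The left side is [1 / (4 sinh (y / 2) ^ 2)]; the right side truncates the
   power series of the denominator. *)
Lemma inv_sinh_sq_le y : 0 < y ->
  exp (- y) / (1 - exp (- y)) ^ 2 <= 1 / (y ^ 2 + y ^ 4 / 12 + y ^ 6 / 360).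
Proof.
  intros Hy. pose proof (exp_ge_taylor7 y) as Hz.
  rewrite exp_Ropp. set (z := exp y - 1).
  assert (E : exp y = 1 + z) by (unfold z; ring). rewrite E in *. clearbody z. clear E.
  assert (Hpow : forall n, 0 < y ^ n) by (intros; apply pow_lt; lra).
  pose proof (Hpow 2%nat). pose proof (Hpow 3%nat). pose proof (Hpow 4%nat).
  pose proof (Hpow 5%nat). pose proof (Hpow 6%nat). pose proof (Hpow 7%nat).
  set (P := y + y ^ 2 / 2 + y ^ 3 / 6 + y ^ 4 / 24 + y ^ 5 / 120 + y ^ 6 / 720 + y ^ 7 / 5040).
  set (D := y ^ 2 + y ^ 4 / 12 + y ^ 6 / 360).
  assert (HPz : P <= z) by (unfold P; lra).
  assert (HP : 0 < P) by (unfold P; lra). assert (HD : 0 < D) by (unfold D; lra).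
  (* This makes $z^2 - D(1+z)$ increasing for $z \ge P$, so its sign need only be known at $z = P$,
     which is [HPP]. *)
  assert (HDP : D <= 2 * P) by (unfold D, P; lra).
  assert (HPP : D * (1 + P) <= P ^ 2).
  { enough (0 <= P ^ 2 - D * (1 + P)) by lra.
    replace (P ^ 2 - D * (1 + P)) with
      (y ^ 8 / 20160 + y ^ 10 / 50400 + y ^ 12 / 725760 + y ^ 14 / 25401600) by (unfold P, D; field).
    pose proof (Hpow 8%nat). pose proof (Hpow 10%nat). pose proof (Hpow 12%nat).
    pose proof (Hpow 14%nat). lra. }
  clearbody P D.
  replace (/ (1 + z) / (1 - / (1 + z)) ^ 2) with ((1 + z) / z ^ 2) by (field; lra).
  assert (0 < z ^ 2) by (apply pow_lt; lra).
  apply Rmult_le_reg_r with (z ^ 2 * D); [now apply Rmult_lt_0_compat|].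
  replace ((1 + z) / z ^ 2 * (z ^ 2 * D)) with (D * (1 + z)) by (field; lra).
  replace (1 / D * (z ^ 2 * D)) with (z ^ 2) by (field; lra).
  nra.
Qed.

Lemma geom1_exp_le y : 0 < y ->
  exp (- y) / (1 - exp (- y)) ^ 2 <= 1 / y ^ 2.
Proof.
  intros Hy. eapply Rle_trans; [now apply inv_sinh_sq_le|].
  assert (Hpow : forall n, 0 < y ^ n) by (intros; apply pow_lt; lra).
  pose proof (Hpow 2%nat). pose proof (Hpow 4%nat). pose proof (Hpow 6%nat).
  unfold Rdiv. rewrite !Rmult_1_l. apply Rinv_le_contravar; lra.
Qed.

Lemma exp_neg_lt_1 y : 0 < y -> 0 < exp (- y) < 1.
Proof.
  intros Hy. split; [apply exp_pos|]. rewrite <- exp_0. apply exp_increasing. lra.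
Qed.

(* With [a = 1 / (4 sinh (y / 2) ^ 2)] the left side is [a * sqrt (1 + 4 * a)]. *)
Lemma geom2_exp_le y : 0 < y ->
  exp (- y) * (1 + exp (- y)) / (1 - exp (- y)) ^ 3 <= 2 / y ^ 3.
Proof.
  intros Hy. pose proof (inv_sinh_sq_le y Hy) as Ha. pose proof (exp_neg_lt_1 y Hy) as Hx.
  set (x := exp (- y)) in *. set (a := x / (1 - x) ^ 2) in *.
  assert (Hv : 0 < y ^ 2) by (apply pow_lt; lra).
  assert (Hy3 : 0 < y ^ 3) by (apply pow_lt; lra).
  assert (Ha0 : 0 < a) by (apply Rdiv_lt_0_compat; [lra|apply pow_lt; lra]).
  set (v := y ^ 2) in *. set (D := v + v ^ 2 / 12 + v ^ 3 / 360).
  replace (v + y ^ 4 / 12 + y ^ 6 / 360) with D in Ha by (unfold D, v; field).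
  apply Rsqr_incr_0_var; [|apply Rlt_le, Rdiv_lt_0_compat; lra]. unfold Rsqr.
  replace (x * (1 + x) / (1 - x) ^ 3 * (x * (1 + x) / (1 - x) ^ 3)) with (a ^ 2 * (1 + 4 * a))
    by (unfold a; field; lra).
  replace (2 / y ^ 3 * (2 / y ^ 3)) with (4 / v ^ 3) by (unfold v; field; lra).
  clearbody a v. clear Hy Hx x Hy3 y.
  assert (Hpow : forall n, 0 < v ^ n) by (intros; apply pow_lt; lra).
  pose proof (Hpow 2%nat). pose proof (Hpow 3%nat). pose proof (Hpow 4%nat).
  pose proof (Hpow 5%nat). pose proof (Hpow 6%nat). pose proof (Hpow 7%nat). pose proof (Hpow 8%nat).
  pose proof (Hpow 9%nat).
  assert (HD : 0 < D) by (unfold D; lra).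
  apply Rle_trans with ((1 / D) ^ 2 * (1 + 4 * (1 / D))).
  { apply Rmult_le_compat; [apply pow2_ge_0|lra|apply pow_incr; lra|lra]. }
  replace ((1 / D) ^ 2 * (1 + 4 * (1 / D))) with ((D + 4) / D ^ 3) by (field; lra).
  assert (HD3 : 0 < D ^ 3) by (apply pow_lt; lra).
  apply Rmult_le_reg_r with (D ^ 3 * v ^ 3); [now apply Rmult_lt_0_compat|].
  replace ((D + 4) / D ^ 3 * (D ^ 3 * v ^ 3)) with ((D + 4) * v ^ 3) by (field; lra).
  replace (4 / v ^ 3 * (D ^ 3 * v ^ 3)) with (4 * D ^ 3) by (field; lra).
  unfold D. lra.
Qed.

(** In terms of $a = 1/(4\sinh^2(y/2))$ the left side is $a(1+6a) = 6/y^4 + 1/120 + O(y^2)$ as $y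
    \to 0$, so a constant slightly above 6 is taken. *)
Lemma geom3_exp_le y : 0 < y ->
  exp (- y) * (1 + 4 * exp (- y) + exp (- y) ^ 2) / (1 - exp (- y)) ^ 4 <= (612 / 100) / y ^ 4.
Proof.
  intros Hy. pose proof (inv_sinh_sq_le y Hy) as Ha. pose proof (exp_neg_lt_1 y Hy) as Hx.
  set (x := exp (- y)) in *. set (a := x / (1 - x) ^ 2) in *.
  assert (Hv : 0 < y ^ 2) by (apply pow_lt; lra).
  assert (Ha0 : 0 < a) by (apply Rdiv_lt_0_compat; [lra|apply pow_lt; lra]).
  set (v := y ^ 2) in *. set (D := v + v ^ 2 / 12 + v ^ 3 / 360).
  replace (v + y ^ 4 / 12 + y ^ 6 / 360) with D in Ha by (unfold D, v; field).
  replace (x * (1 + 4 * x + x ^ 2) / (1 - x) ^ 4) with (a * (1 + 6 * a))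
    by (unfold a; field; lra).
  replace (y ^ 4) with (v ^ 2) by (unfold v; ring).
  clearbody a v. clear Hy Hx x y.
  assert (Hpow : forall n, 0 < v ^ n) by (intros; apply pow_lt; lra).
  pose proof (Hpow 2%nat). pose proof (Hpow 3%nat). pose proof (Hpow 4%nat).
  pose proof (Hpow 5%nat). pose proof (Hpow 6%nat).
  assert (HD : 0 < D) by (unfold D; lra).
  apply Rle_trans with ((1 / D) * (1 + 6 * (1 / D))).
  { apply Rmult_le_compat; lra. }
  replace ((1 / D) * (1 + 6 * (1 / D))) with ((D + 6) / D ^ 2) by (field; lra).
  assert (HD2 : 0 < D ^ 2) by (apply pow_lt; lra).
  apply Rmult_le_reg_r with (D ^ 2 * v ^ 2); [now apply Rmult_lt_0_compat|].
  replace ((D + 6) / D ^ 2 * (D ^ 2 * v ^ 2)) with ((D + 6) * v ^ 2) by (field; lra).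
  replace (612 / 100 / v ^ 2 * (D ^ 2 * v ^ 2)) with (612 / 100 * D ^ 2) by (field; lra).
  enough (0 <= 612 / 100 * (1 + v / 12 + v ^ 2 / 360) ^ 2 - (6 + v + v ^ 2 / 12 + v ^ 3 / 360)) as Hp.
  { apply (Rmult_le_compat_l (v ^ 2)) in Hp; [|lra]. unfold D. lra. }
  (* The polynomial is close to its small positive minimum near $v = 7$; the squares are centred
     there. *)
  assert (Hv7 : 0 <= v * (v - 7) ^ 2) by (apply Rmult_le_pos; [lra|apply pow2_ge_0]).
  pose proof (pow2_ge_0 (v ^ 2 - 49)). pose proof (pow2_ge_0 (v - 7)). nra.
Qed.

(** * Positivity of the oscillatory integral *)

Lemma RInt_ge_primitive (f G g : R -> R) (a b : R) :
  a <= b -> ex_RInt f a b ->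
  (forall x, a <= x <= b -> is_derive G x (g x)) ->
  (forall x, a <= x <= b -> continuous g x) ->
  (forall x, a < x < b -> g x <= f x) -> G b - G a <= RInt f a b.
Proof.
  intros Hab Hf HG Hg Hgf.
  assert (H : is_RInt g a b (minus (G b) (G a))).
  { apply (is_RInt_derive G g); rewrite Rmin_left, Rmax_right by lra; auto. }
  change (G b - G a) with (minus (G b) (G a)).
  rewrite <- (is_RInt_unique _ _ _ _ H).
  apply RInt_le; auto. now exists (minus (G b) (G a)).
Qed.

(* [s] is the width of the peak at 0, of order [t ^ (3 / 2)].  The main term comes
   from [0, 2 s]; on [2 s, 16 / 5 s] the phase [X] stays below [PI / 2]; on
   [16 / 5 s, 2 t] and [2 t, PI] the lower bound for [V] makes the integrand small. *)
Lemma oscillatory_core (V X : R -> R) (t s : R) :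
  0 < t <= 1 / 13 -> 0 < s -> 10 * s ^ 2 <= t ^ 3 ->
  ex_RInt (fun x => exp (- V x) * cos (X x) * (1 - cos x)) 0 (2 * s) ->
  (forall x, 0 <= x <= PI -> V x <= x ^ 2 / (2 * s ^ 2)) ->
  (forall x, 0 <= x <= PI -> Rabs (X x) <= 51 / 100 * x ^ 3 / (s ^ 2 * t)) ->
  365 / 1000 * s ^ 3 <= RInt (fun x => exp (- V x) * cos (X x) * (1 - cos x)) 0 (2 * s).
Proof.
  intros Ht Hs Hst Hint HV HX.
  assert (Hs2 : 0 < s ^ 2) by (apply pow_lt; lra).
  (* From $10 s^2 \le t^3 \le t^2/13$. The resulting $s/t < 1/11.4$ governs the numerical bounds
     here and in the next lemmas. *)
  assert (Hst2 : 130 * s ^ 2 <= t ^ 2) by (simpl in *; nra).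
  assert (Hs3 : 0 < s ^ 3) by (apply pow_lt; lra).
  (* [c] bounds from below the product of [cos (X x)] and $(1-\cos x)/(x^2/2)$ on $[0, 2s]$. The
     fourth power in [g] is a polynomial minorant of $e^{-x^2/(2s^2)}$, from $1 - z \le e^{-z}$ with
     $z = x^2/(8s^2)$. *)
  set (c := 935 / 1000).
  set (G := fun x => c / 2 * (x ^ 3 / 3 - x ^ 5 / (10 * s ^ 2) + 3 * x ^ 7 / (224 * s ^ 4)
    - x ^ 9 / (1152 * s ^ 6) + x ^ 11 / (45056 * s ^ 8))).
  set (g := fun x => c * (x ^ 2 / 2) * (1 - x ^ 2 / (8 * s ^ 2)) ^ 4).
  apply Rle_trans with (G (2 * s) - G 0).
  { unfold G, c. replace (_ - _) with (s ^ 3 * (c / 2 * (8 / 3 - 32 / 10 + 3 * 128 / 224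
      - 512 / 1152 + 2048 / 45056))) by (unfold c; field; lra). unfold c. nra. }
  apply RInt_ge_primitive with g; [lra|exact Hint| | |].
  - intros x _. unfold G, g, c. auto_derive; [auto|]. field. lra.
  - intros x _. apply (ex_derive_continuous g). unfold g. auto_derive. auto.
  - intros x Hx. unfold g.
    assert (Hst1 : 11 * s <= t) by nra.
    pose proof PI2_3_2 as Hpi.
    assert (HxPI : 0 <= x <= PI) by lra.
    specialize (HV x HxPI). specialize (HX x HxPI).
    set (z := x ^ 2 / (8 * s ^ 2)).
    assert (Hx2 : x ^ 2 <= 4 * s ^ 2) by nra.
    assert (Hz : 0 <= z <= 1 / 2).
    { unfold z. split.
      - apply Rmult_le_pos; [apply pow2_ge_0|left; apply Rinv_0_lt_compat; lra].
      - apply Rmult_le_reg_r with (8 * s ^ 2); [lra|].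
        replace (x ^ 2 / (8 * s ^ 2) * (8 * s ^ 2)) with (x ^ 2) by (field; lra). lra. }
    assert (HE : (1 - z) ^ 4 <= exp (- V x)).
    { apply Rle_trans with (exp (INR 4 * - z)).
      - rewrite exp_INR_mul. apply pow_incr. pose proof (one_sub_le_exp_neg z). lra.
      - apply exp_le. replace (INR 4 * - z) with (- (x ^ 2 / (2 * s ^ 2))) by (unfold z; simpl; field; lra).
        lra. }
    assert (HXb : Rabs (X x) <= 358 / 1000).
    { eapply Rle_trans; [exact HX|].
      assert (x ^ 3 <= 8 * s ^ 3).
      { replace (8 * s ^ 3) with ((2 * s) ^ 3) by ring. apply pow_incr. lra. }
      apply Rmult_le_reg_r with (s ^ 2 * t); [apply Rmult_lt_0_compat; lra|].
      replace (51 / 100 * x ^ 3 / (s ^ 2 * t) * (s ^ 2 * t)) with (51 / 100 * x ^ 3)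
        by (field; split; lra).
      assert (Hq : 408 / 358 * 10 * s <= t) by nra.
      assert (s ^ 2 * (408 / 358 * 10 * s) <= s ^ 2 * t) by (apply Rmult_le_compat_l; lra).
      simpl in *. lra. }
    assert (HC : 9359 / 10000 <= cos (X x)).
    { pose proof (cos_ge (X x)) as Hc.
      assert (X x ^ 2 <= (358 / 1000) ^ 2) by (apply pow_maj_Rabs; exact HXb). lra. }
    assert (HH : x ^ 2 / 2 * (9999 / 10000) <= 1 - cos x).
    { pose proof (cos_le_pos x (proj1 HxPI)) as Hc. pose proof (pow2_ge_0 x).
      assert (x ^ 2 <= 1 / 1000).
      { assert (t ^ 2 <= 1 / 169) by nra. nra. }
      assert (x ^ 4 <= x ^ 2 * (1 / 1000)).
      { replace (x ^ 4) with (x ^ 2 * x ^ 2) by ring. apply Rmult_le_compat_l; [apply pow2_ge_0|lra]. }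
      lra. }
    fold z. pose proof (pow2_ge_0 x) as Hxx.
    assert (HE0 : 0 <= (1 - z) ^ 4) by (apply pow_le; lra).
    apply Rle_trans with ((1 - z) ^ 4 * (9359 / 10000) * (x ^ 2 / 2 * (9999 / 10000))).
    + unfold c. nra.
    + apply Rmult_le_compat; [nra|lra| |exact HH].
      apply Rmult_le_compat; lra.
Qed.

Lemma oscillatory_middle (V X : R -> R) (t s : R) :
  0 < t <= 1 / 13 -> 0 < s -> 10 * s ^ 2 <= t ^ 3 ->
  ex_RInt (fun x => exp (- V x) * cos (X x) * (1 - cos x)) (2 * s) (16 / 5 * s) ->
  (forall x, 0 <= x <= PI -> Rabs (X x) <= 51 / 100 * x ^ 3 / (s ^ 2 * t)) ->
  0 <= RInt (fun x => exp (- V x) * cos (X x) * (1 - cos x)) (2 * s) (16 / 5 * s).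
Proof.
  intros Ht Hs Hst Hint HX.
  assert (Hs2 : 0 < s ^ 2) by (apply pow_lt; lra).
  assert (Hst2 : 130 * s ^ 2 <= t ^ 2) by (simpl in *; nra).
  assert (Hst1 : 114 / 10 * s <= t) by nra.
  apply RInt_ge_0; [lra|exact Hint|]. intros x Hx.
  pose proof PI2_3_2 as Hpi.
  (* Here $0.51 \cdot 3.2^3 / 11.4 < 3/2 < \pi/2$, which is why the interval can reach
     [16 / 5 * s]. *)
  assert (HXb : Rabs (X x) <= 3 / 2).
  { eapply Rle_trans; [apply HX; lra|].
    assert (x ^ 3 <= (16 / 5) ^ 3 * s ^ 3).
    { rewrite <- Rpow_mult_distr. apply pow_incr. lra. }
    apply Rmult_le_reg_r with (s ^ 2 * t); [apply Rmult_lt_0_compat; lra|].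
    replace (51 / 100 * x ^ 3 / (s ^ 2 * t) * (s ^ 2 * t)) with (51 / 100 * x ^ 3)
      by (field; split; lra).
    assert (s ^ 2 * (114 / 10 * s) <= s ^ 2 * t) by (apply Rmult_le_compat_l; lra).
    assert (0 < s ^ 3) by (apply pow_lt; lra).
    replace (s ^ 2 * (114 / 10 * s)) with (114 / 10 * s ^ 3) in * by ring. lra. }
  apply Rabs_le_between in HXb.
  apply Rmult_le_pos; [apply Rmult_le_pos|].
  - left; apply exp_pos.
  - apply cos_ge_0; lra.
  - pose proof (COS_bound x). lra.
Qed.

Lemma ratio_mono a h0 h : 0 < a -> 0 <= h0 <= h -> h0 / (a + 2 * h0) <= h / (a + 2 * h).
Proof.
  intros Ha Hh. apply Rmult_le_reg_r with ((a + 2 * h0) * (a + 2 * h)); [nra|].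
  replace (h0 / (a + 2 * h0) * ((a + 2 * h0) * (a + 2 * h))) with (h0 * (a + 2 * h)) by (field; lra).
  replace (h / (a + 2 * h) * ((a + 2 * h0) * (a + 2 * h))) with (h * (a + 2 * h0)) by (field; lra).
  nra.
Qed.

(* Absorbs the additive error [1 / 1000] in the lower bounds for [V]. *)
Lemma exp_neg_le_of_ge v y : y - 1 / 1000 <= v -> exp (- v) <= 1002 / 1000 * exp (- y).
Proof.
  intros H. apply Rle_trans with (exp (- y + 1 / 1000)); [apply exp_le; lra|].
  rewrite exp_plus. rewrite Rmult_comm. apply Rmult_le_compat_r; [left; apply exp_pos|].
  pose proof (one_sub_le_exp_neg (1 / 1000)) as H1. pose proof (exp_pos (1 / 1000)).
  assert (exp (1 / 1000) * exp (- (1 / 1000)) = 1)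
    by (rewrite <- exp_plus, Rplus_opp_r; apply exp_0).
  nra.
Qed.

Lemma oscillatory_tail (V X : R -> R) (t s : R) :
  0 < t <= 1 / 13 -> 0 < s -> 10 * s ^ 2 <= t ^ 3 ->
  ex_RInt (fun x => exp (- V x) * cos (X x) * (1 - cos x)) (16 / 5 * s) (2 * t) ->
  (forall x, 0 < x <= PI ->
    6 / 10 * t ^ 2 / s ^ 2 * ((1 - cos x) / (1001 / 1000 * t ^ 2 + 2 * (1 - cos x))) - 1 / 1000 <= V x) ->
  - (316 / 1000) * s ^ 3 <= RInt (fun x => exp (- V x) * cos (X x) * (1 - cos x)) (16 / 5 * s) (2 * t).
Proof.
  intros Ht Hs Hst Hint HV.
  assert (Hs2 : 0 < s ^ 2) by (apply pow_lt; lra).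
  assert (Ht2 : 0 < t ^ 2) by (apply pow_lt; lra).
  assert (Hst2 : 130 * s ^ 2 <= t ^ 2) by (simpl in *; nra).
  assert (Hst1 : 114 / 10 * s <= t) by nra.
  (* The bound $e^{-y} \le (4/(2.71\,y))^4$ is used with the [y] below; 297.6 rounds up
     $0.501\,(4/(2.71 \cdot 0.299))^4$. Only even powers occur in $(t^2+x^2)^4/x^6$, so the
     primitive [G] contains no logarithm. *)
  set (c := 2976 / 10 * (s / t) ^ 8).
  assert (Hst8 : 0 < (s / t) ^ 8) by (apply pow_lt, Rdiv_lt_0_compat; lra).
  set (g := fun x => - c * ((t ^ 2 + x ^ 2) ^ 4 / x ^ 6)).
  set (G := fun x => - c * (x ^ 3 / 3 + 4 * t ^ 2 * x - 6 * t ^ 4 / x - 4 / 3 * t ^ 6 / x ^ 3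
    - t ^ 8 / (5 * x ^ 5))).
  apply Rle_trans with (G (2 * t) - G (16 / 5 * s)).
  { unfold G, c. set (q := s / t). assert (Es : s = q * t) by (unfold q; field; lra).
    assert (Hq : 0 < q) by (apply Rdiv_lt_0_compat; lra).
    assert (Hq2 : q ^ 2 <= 1 / 130).
    { apply Rmult_le_reg_r with (t ^ 2); [lra|]. rewrite <- Rpow_mult_distr, <- Es. lra. }
    assert (Hq1 : q <= 1 / 11) by nra.
    rewrite Es. replace (_ - _) with (- (2976 / 10 * (q * t) ^ 3 *
      ((8 / 3 + 8 - 3 - 1 / 6 - 1 / 160) * q ^ 5 - (16 / 5) ^ 3 / 3 * q ^ 8 - 64 / 5 * q ^ 6
       + 15 / 8 * q ^ 4 + 4 / 3 * (5 / 16) ^ 3 * q ^ 2 + (5 / 16) ^ 5 / 5))) by (field; lra).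
    rewrite <- Ropp_mult_distr_l. apply Ropp_le_contravar.
    replace (316 / 1000 * (q * t) ^ 3) with ((q * t) ^ 3 * (316 / 1000)) by ring.
    replace (2976 / 10 * (q * t) ^ 3 * _) with ((q * t) ^ 3 * (2976 / 10 *
      ((8 / 3 + 8 - 3 - 1 / 6 - 1 / 160) * q ^ 5 - (16 / 5) ^ 3 / 3 * q ^ 8 - 64 / 5 * q ^ 6
       + 15 / 8 * q ^ 4 + 4 / 3 * (5 / 16) ^ 3 * q ^ 2 + (5 / 16) ^ 5 / 5))) by ring.
    apply Rmult_le_compat_l; [apply pow_le, Rmult_le_pos; lra|].
    assert (H4 : q ^ 4 <= (1 / 130) ^ 2).
    { replace (q ^ 4) with ((q ^ 2) ^ 2) by ring. apply pow_incr. split; [apply pow2_ge_0|lra]. }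
    assert (0 < q ^ 4) by (apply pow_lt; lra).
    assert (H5 : q ^ 5 <= (1 / 130) ^ 2 * (1 / 11)).
    { replace (q ^ 5) with (q ^ 4 * q) by ring. apply Rmult_le_compat; lra. }
    assert (0 < q ^ 6) by (apply pow_lt; lra). assert (0 < q ^ 8) by (apply pow_lt; lra).
    lra. }
  apply RInt_ge_primitive with g; [lra|exact Hint| | |].
  - intros x Hx. unfold G, g. auto_derive.
    + repeat split; try (apply Rgt_not_eq; lra); auto; repeat apply Rmult_integral_contrapositive_currified; lra.
    + field. lra.
  - intros x Hx. apply (ex_derive_continuous g). unfold g. auto_derive.
    repeat apply Rmult_integral_contrapositive_currified; lra.
  - intros x Hx. pose proof PI2_3_2 as Hpi.
    assert (Hx2 : 0 < x ^ 2) by (apply pow_lt; lra).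
    assert (Hh : 998 / 1000 * (x ^ 2 / 2) <= 1 - cos x).
    { assert (0 <= x) as Hx0 by lra. pose proof (cos_le_pos x Hx0).
      assert (x ^ 2 <= 4 / 169) by nra.
      assert (x ^ 4 <= x ^ 2 * (4 / 169)).
      { replace (x ^ 4) with (x ^ 2 * x ^ 2) by ring. apply Rmult_le_compat_l; lra. }
      lra. }
    (* 0.299 lies just below $0.6 \cdot 0.499 / 1.001$, the constant left after replacing $1 - \cos
       x$ by $0.499\,x^2$; [ratio_mono] justifies the replacement. *)
    set (y := 299 / 1000 * t ^ 2 * x ^ 2 / (s ^ 2 * (t ^ 2 + x ^ 2))).
    assert (Hy : 0 < y).
    { apply Rdiv_lt_0_compat; [|apply Rmult_lt_0_compat; lra].
      repeat apply Rmult_lt_0_compat; lra. }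
    assert (HVy : y - 1 / 1000 <= V x).
    { eapply Rle_trans; [|apply HV; lra]. apply Rplus_le_compat_r.
      apply Rle_trans with (6 / 10 * t ^ 2 / s ^ 2 *
        (499 / 1000 * x ^ 2 / (1001 / 1000 * t ^ 2 + 2 * (499 / 1000 * x ^ 2)))).
      - apply Rle_trans with (6 / 10 * t ^ 2 / s ^ 2 *
          (499 / 1000 * x ^ 2 / (1001 / 1000 * (t ^ 2 + x ^ 2)))).
        + unfold y. apply Rmult_le_reg_r with (s ^ 2 * (t ^ 2 + x ^ 2)); [apply Rmult_lt_0_compat; lra|].
          replace (299 / 1000 * t ^ 2 * x ^ 2 / (s ^ 2 * (t ^ 2 + x ^ 2)) * (s ^ 2 * (t ^ 2 + x ^ 2)))
            with (299 / 1000 * (t ^ 2 * x ^ 2)) by (field; split; lra).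
          replace (6 / 10 * t ^ 2 / s ^ 2 * (499 / 1000 * x ^ 2 / (1001 / 1000 * (t ^ 2 + x ^ 2)))
            * (s ^ 2 * (t ^ 2 + x ^ 2))) with (6 / 10 * 499 / 1001 * (t ^ 2 * x ^ 2))
            by (field; split; lra).
          assert (0 < t ^ 2 * x ^ 2) by (apply Rmult_lt_0_compat; lra). lra.
        + apply Rmult_le_compat_l.
          { left. apply Rdiv_lt_0_compat; lra. }
          apply Rmult_le_compat_l; [lra|]. apply Rinv_le_contravar; lra.
      - apply Rmult_le_compat_l.
        { left. apply Rdiv_lt_0_compat; lra. }
        apply ratio_mono; lra. }
    assert (HE : exp (- V x) <= 1002 / 1000 * (4 / (271 / 100 * y)) ^ 4).
    { eapply Rle_trans; [apply exp_neg_le_of_ge, HVy|].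
      apply Rmult_le_compat_l; [lra|].
      replace 4 with (INR 4) at 1 by (simpl; ring). apply exp_neg_le_pow; [lia|exact Hy]. }
    assert (HEg : exp (- V x) * (x ^ 2 / 2) <= c * ((t ^ 2 + x ^ 2) ^ 4 / x ^ 6)).
    { apply Rle_trans with (1002 / 1000 * (4 / (271 / 100 * y)) ^ 4 * (x ^ 2 / 2)).
      { apply Rmult_le_compat_r; [lra|exact HE]. }
      replace (1002 / 1000 * (4 / (271 / 100 * y)) ^ 4 * (x ^ 2 / 2)) with
        (1002 / 1000 / 2 * (4 / (271 / 100 * (299 / 1000))) ^ 4 *
          ((s / t) ^ 8 * ((t ^ 2 + x ^ 2) ^ 4 / x ^ 6))) by (unfold y; field; repeat split; lra).
      unfold c. rewrite (Rmult_assoc (2976 / 10)). apply Rmult_le_compat_r; [|lra].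
      apply Rmult_le_pos; [lra|]. apply Rmult_le_pos; [apply pow_le; lra|].
      left. apply Rinv_0_lt_compat, pow_lt. lra. }
    unfold g. rewrite <- Ropp_mult_distr_l.
    pose proof (exp_pos (- V x)). pose proof (COS_bound (X x)). pose proof (COS_bound x).
    pose proof (cos_ge x).
    assert (exp (- V x) * (1 - cos x) <= exp (- V x) * (x ^ 2 / 2)) by (apply Rmult_le_compat_l; lra).
    assert (0 <= exp (- V x) * (1 - cos x)) by (apply Rmult_le_pos; lra).
    replace (exp (- V x) * cos (X x) * (1 - cos x)) with (exp (- V x) * (1 - cos x) * cos (X x)) by ring.
    nra.
Qed.

Lemma oscillatory_far (V X : R -> R) (t s : R) :
  0 < t <= 1 / 13 -> 0 < s -> 10 * s ^ 2 <= t ^ 3 ->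
  ex_RInt (fun x => exp (- V x) * cos (X x) * (1 - cos x)) (2 * t) PI ->
  (forall x, 0 < x <= PI ->
    6 / 10 * t ^ 2 / s ^ 2 * ((1 - cos x) / (1001 / 1000 * t ^ 2 + 2 * (1 - cos x))) - 1 / 1000 <= V x) ->
  - (1 / 100) * s ^ 3 <= RInt (fun x => exp (- V x) * cos (X x) * (1 - cos x)) (2 * t) PI.
Proof.
  intros Ht Hs Hst Hint HV.
  assert (Hs2 : 0 < s ^ 2) by (apply pow_lt; lra).
  assert (Ht2 : 0 < t ^ 2) by (apply pow_lt; lra).
  assert (Hst2 : 130 * s ^ 2 <= t ^ 2) by (simpl in *; nra).
  set (q := s / t). assert (Es : s = q * t) by (unfold q; field; lra).
  assert (Hq : 0 < q) by (apply Rdiv_lt_0_compat; lra).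
  assert (Hq2 : q ^ 2 <= 1 / 130).
  { apply Rmult_le_reg_r with (t ^ 2); [lra|]. rewrite <- Rpow_mult_distr, <- Es. lra. }
  (* 24.65 rounds up $16/(2.71 \cdot 0.2397)$ and 3 rounds up $2 \cdot 1.002$. As $t \ge 10 q^2$,
     one has $s^3 \ge 1000\,q^9$; the other 23 factors [q], with $q^2 \le 1/130$, outweigh
     $24.65^{16}$. *)
  set (K := 3 * (2465 / 100 * q ^ 2) ^ 16).
  pose proof PI2_3_2 as Hpi. pose proof PI_4 as Hpi4.
  apply Rle_trans with ((fun x => - K * x) PI - (fun x => - K * x) (2 * t)).
  { cbn beta.
    assert (HK : 4 * K <= 1 / 100 * s ^ 3).
    { assert (Ht10 : 10 * q ^ 2 <= t).
      { apply Rmult_le_reg_r with (t ^ 2); [lra|].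
        replace (10 * q ^ 2 * t ^ 2) with (10 * (q * t) ^ 2) by ring. rewrite <- Es.
        simpl in *. lra. }
      assert (0 < q ^ 2) by (apply pow_lt; lra).
      assert (H1 : 1000 * (q ^ 2) ^ 3 <= t ^ 3).
      { replace (1000 * (q ^ 2) ^ 3) with ((10 * q ^ 2) ^ 3) by ring. apply pow_incr. lra. }
      assert (Hq3 : 0 < q ^ 3) by (apply pow_lt; lra).
      assert (H2 : q ^ 3 * (1000 * (q ^ 2) ^ 3) <= s ^ 3).
      { rewrite Es, Rpow_mult_distr. apply Rmult_le_compat_l; lra. }
      assert (H3 : (q ^ 2) ^ 11 <= (1 / 130) ^ 11) by (apply pow_incr; lra).
      assert (H9 : 0 < q ^ 9) by (apply pow_lt; lra).
      unfold K. replace ((2465 / 100 * q ^ 2) ^ 16) with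
        ((2465 / 100) ^ 16 * (q ^ 9 * (q * (q ^ 2) ^ 11))) by ring.
      assert (H4 : q * (q ^ 2) ^ 11 <= 1 * (1 / 130) ^ 11).
      { apply Rmult_le_compat; try lra; [apply pow_le; lra|nra]. }
      assert (H5 : q ^ 9 * (q * (q ^ 2) ^ 11) <= q ^ 9 * (1 * (1 / 130) ^ 11))
        by (apply Rmult_le_compat_l; lra).
      replace (q ^ 3 * (1000 * (q ^ 2) ^ 3)) with (1000 * q ^ 9) in H2 by ring.
      lra. }
    assert (0 <= K).
    { unfold K. apply Rmult_le_pos; [lra|]. apply pow_le, Rmult_le_pos; [lra|apply pow2_ge_0]. }
    nra. }
  apply (RInt_ge_primitive _ (fun x => - K * x) (fun _ => - K)); [lra|exact Hint| | |].
  - intros x _. auto_derive; auto; ring.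
  - intros x _. apply continuous_const.
  - intros x Hx.
    assert (Hh : 1995 / 1000 * t ^ 2 <= 1 - cos x).
    { assert (cos x <= cos (2 * t)) by (apply cos_decr_1; lra).
      assert (0 <= 2 * t) as H2t by lra. pose proof (cos_le_pos (2 * t) H2t) as Hc.
      assert (t ^ 2 <= 1 / 169) by nra.
      assert (t ^ 4 <= t ^ 2 * (1 / 169)).
      { replace (t ^ 4) with (t ^ 2 * t ^ 2) by ring. apply Rmult_le_compat_l; lra. }
      replace ((2 * t) ^ 2) with (4 * t ^ 2) in Hc by ring.
      replace ((2 * t) ^ 4) with (16 * t ^ 4) in Hc by ring. lra. }
    set (y := 2397 / 10000 / q ^ 2).
    assert (Hq2' : 0 < q ^ 2) by (apply pow_lt; lra).
    assert (Hy : 0 < y) by (apply Rdiv_lt_0_compat; lra).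
    assert (HVy : y - 1 / 1000 <= V x).
    { eapply Rle_trans; [|apply HV; lra]. apply Rplus_le_compat_r.
      apply Rle_trans with (6 / 10 * t ^ 2 / s ^ 2 *
        (1995 / 1000 * t ^ 2 / (1001 / 1000 * t ^ 2 + 2 * (1995 / 1000 * t ^ 2)))).
      - unfold y. rewrite Es.
        replace (6 / 10 * t ^ 2 / (q * t) ^ 2 *
          (1995 / 1000 * t ^ 2 / (1001 / 1000 * t ^ 2 + 2 * (1995 / 1000 * t ^ 2))))
          with (6 / 10 * (1995 / 4991) / q ^ 2) by (field; lra).
        apply Rmult_le_compat_r; [left; now apply Rinv_0_lt_compat|lra].
      - apply Rmult_le_compat_l.
        { left. apply Rdiv_lt_0_compat; lra. }
        apply ratio_mono; lra. }
    assert (HE : exp (- V x) <= 1002 / 1000 * (2465 / 100 * q ^ 2) ^ 16).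
    { eapply Rle_trans; [apply exp_neg_le_of_ge, HVy|].
      apply Rmult_le_compat_l; [lra|].
      eapply Rle_trans; [apply (exp_neg_le_pow 16); [lia|exact Hy]|].
      apply pow_incr. split.
      { apply Rmult_le_pos; [apply pos_INR|]. left. apply Rinv_0_lt_compat. lra. }
      replace (INR 16 / (271 / 100 * y)) with (16 / (271 / 100 * (2397 / 10000)) * q ^ 2)
        by (unfold y; simpl; field; lra).
      apply Rmult_le_compat_r; lra. }
    unfold K. set (Z := (2465 / 100 * q ^ 2) ^ 16) in *.
    pose proof (exp_pos (- V x)). pose proof (COS_bound (X x)). pose proof (COS_bound x).
    assert (0 <= exp (- V x) * (1 - cos x)) by (apply Rmult_le_pos; lra).
    assert (exp (- V x) * (1 - cos x) <= exp (- V x) * 2) by (apply Rmult_le_compat_l; lra).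
    replace (exp (- V x) * cos (X x) * (1 - cos x)) with (exp (- V x) * (1 - cos x) * cos (X x)) by ring.
    nra.
Qed.

(** The balance of the four pieces, in units of $s^3$, is $0.365 + 0 - 0.316 - 0.010 > 0$. *)
Lemma oscillatory_pos (V X : R -> R) (t s : R) :
  0 < t <= 1 / 13 -> 0 < s -> 10 * s ^ 2 <= t ^ 3 ->
  (forall a b, ex_RInt (fun x => exp (- V x) * cos (X x) * (1 - cos x)) a b) ->
  (forall x, 0 <= x <= PI -> V x <= x ^ 2 / (2 * s ^ 2)) ->
  (forall x, 0 <= x <= PI -> Rabs (X x) <= 51 / 100 * x ^ 3 / (s ^ 2 * t)) ->
  (forall x, 0 < x <= PI ->
    6 / 10 * t ^ 2 / s ^ 2 * ((1 - cos x) / (1001 / 1000 * t ^ 2 + 2 * (1 - cos x))) - 1 / 1000 <= V x) ->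
  0 < RInt (fun x => exp (- V x) * cos (X x) * (1 - cos x)) 0 PI.
Proof.
  intros Ht Hs Hst Hint HV HX HVl.
  pose proof (oscillatory_core V X t s Ht Hs Hst (Hint _ _) HV HX).
  pose proof (oscillatory_middle V X t s Ht Hs Hst (Hint _ _) HX).
  pose proof (oscillatory_tail V X t s Ht Hs Hst (Hint _ _) HVl).
  pose proof (oscillatory_far V X t s Ht Hs Hst (Hint _ _) HVl).
  rewrite <- (RInt_Chasles _ 0 (2 * t) PI) by apply Hint.
  rewrite <- (RInt_Chasles _ 0 (16 / 5 * s) (2 * t)) by apply Hint.
  rewrite <- (RInt_Chasles _ 0 (2 * s) (16 / 5 * s)) by apply Hint.
  unfold plus; simpl. assert (0 < s ^ 3) by (apply pow_lt; lra). simpl in *. lra.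
Qed.

(** * The weights of the coloured partition function *)

(** The pair $(d, e)$ stands for the term $q^{de}/d$ of $-\log(1 - q^e)$. Cutting both indices at
    [M] does not change the coefficients up to degree [M] of the exponential. *)
Definition pairs (M : nat) : list (nat * nat) := list_prod (seq 1 M) (seq 1 M).

Definition freq (de : nat * nat) : nat := (fst de * snd de)%nat.

(* The coefficient of [q ^ freq de] in the logarithm of [prod (1 - q ^ e) ^ (- k)]. *)
Definition weight (k r : R) (de : nat * nat) : R := k / INR (fst de) * r ^ freq de.

Lemma in_pairs M d e : In (d, e) (pairs M) -> (1 <= d <= M)%nat /\ (1 <= e <= M)%nat.
Proof. unfold pairs. rewrite in_prod_iff, !in_seq. lia. Qed.

Lemma freq_pos M de : In de (pairs M) -> (1 <= freq de)%nat.
Proof. destruct de as [d e]. intros H%in_pairs. unfold freq; simpl. nia. Qed.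

Lemma weight_pos M k r de : 0 < k -> 0 < r -> In de (pairs M) -> 0 < weight k r de.
Proof.
  destruct de as [d e]. intros Hk Hr H%in_pairs. unfold weight; simpl.
  apply Rmult_lt_0_compat; [apply Rdiv_lt_0_compat|apply pow_lt]; auto.
  apply lt_0_INR. lia.
Qed.

Lemma exp_neg_pow t n : exp (- t) ^ n = exp (- (INR n * t)).
Proof. rewrite <- exp_INR_mul. f_equal. ring. Qed.

(** For fixed $d$ the hypothesis is applied at $y = dt$: the sum over $e$ is at most $k d^p
    C/(dt)^{p+2}$, that is $Ck\,t^{-p-2}/d^2$, and $\sum_d 1/d^2 \le 5/3$. *)
Lemma lsum_pairs_moment (p : nat) (C k t : R) (M : nat) :
  0 < k -> 0 < t -> 0 <= C ->
  (forall y, 0 < y -> lsum (seq 1 M) (fun e => INR e ^ S p * exp (- y) ^ e) <= C / y ^ S (S p)) ->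
  lsum (pairs M) (fun de => INR (freq de) ^ S p * weight k (exp (- t)) de)
    <= 5 / 3 * C * k / t ^ S (S p).
Proof.
  intros Hk Ht HC H. unfold pairs. rewrite lsum_list_prod.
  apply Rle_trans with (lsum (seq 1 M) (fun d => C * k / t ^ S (S p) * / INR d ^ 2)).
  - apply lsum_le. intros d Hd%in_seq.
    assert (Hd0 : 0 < INR d) by (apply lt_0_INR; lia).
    rewrite (lsum_ext _ _ (fun e => k * INR d ^ p * (INR e ^ S p * exp (- (INR d * t)) ^ e))).
    2:{ intros e _. unfold weight, freq; simpl fst; simpl snd.
        rewrite mult_INR, pow_mult, exp_neg_pow, Rpow_mult_distr. simpl. field. lra. }
    rewrite lsum_scal.
    apply Rle_trans with (k * INR d ^ p * (C / (INR d * t) ^ S (S p))).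
    + apply Rmult_le_compat_l.
      * apply Rmult_le_pos; [lra|apply pow_le; lra].
      * apply H. now apply Rmult_lt_0_compat.
    + right. rewrite Rpow_mult_distr.
      replace (INR d ^ S (S p)) with (INR d ^ 2 * INR d ^ p) by (simpl; ring).
      assert (INR d ^ p <> 0) by (apply pow_nonzero; lra).
      assert (t ^ S (S p) <> 0) by (apply pow_nonzero; lra).
      field. repeat split; lra.
  - rewrite lsum_scal. pose proof (lsum_inv_sq_le M).
    assert (0 <= C * k / t ^ S (S p)).
    { apply Rmult_le_pos; [apply Rmult_le_pos; lra|].
      left. now apply Rinv_0_lt_compat, pow_lt. }
    apply Rle_trans with (C * k / t ^ S (S p) * (5 / 3)); [now apply Rmult_le_compat_l|].
    right. unfold Rdiv. ring.
Qed.

Lemma moment1_le k t M : 0 < k -> 0 < t ->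
  lsum (pairs M) (fun de => INR (freq de) * weight k (exp (- t)) de) <= 5 / 3 * k / t ^ 2.
Proof.
  intros Hk Ht.
  rewrite (lsum_ext _ _ (fun de => INR (freq de) ^ 1 * weight k (exp (- t)) de)) by (intros; ring).
  replace (5 / 3 * k / t ^ 2) with (5 / 3 * 1 * k / t ^ 2) by (field; lra).
  apply lsum_pairs_moment; try lra. intros y Hy.
  eapply Rle_trans; [|apply geom1_exp_le, Hy].
  eapply Rle_trans; [|apply (geom_sum1_le _ M), exp_neg_lt_1, Hy].
  right. apply lsum_ext; intros; ring.
Qed.

Lemma moment2_le k t M : 0 < k -> 0 < t ->
  lsum (pairs M) (fun de => INR (freq de) ^ 2 * weight k (exp (- t)) de) <= 10 / 3 * k / t ^ 3.
Proof.
  intros Hk Ht.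
  replace (10 / 3 * k / t ^ 3) with (5 / 3 * 2 * k / t ^ 3) by (field; lra).
  apply lsum_pairs_moment; try lra. intros y Hy.
  eapply Rle_trans; [|apply geom2_exp_le, Hy].
  apply geom_sum2_le, exp_neg_lt_1, Hy.
Qed.

Lemma moment3_le k t M : 0 < k -> 0 < t ->
  lsum (pairs M) (fun de => INR (freq de) ^ 3 * weight k (exp (- t)) de) <= 102 / 10 * k / t ^ 4.
Proof.
  intros Hk Ht.
  replace (102 / 10 * k / t ^ 4) with (5 / 3 * (612 / 100) * k / t ^ 4) by (field; lra).
  apply lsum_pairs_moment; try lra. intros y Hy.
  eapply Rle_trans; [|apply geom3_exp_le, Hy].
  apply geom_sum3_le, exp_neg_lt_1, Hy.
Qed.

Lemma lsum_pairs_ge (g : nat * nat -> R) (M : nat) :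
  (forall de, In de (pairs M) -> 0 <= g de) ->
  lsum (seq 1 M) (fun e => g (1%nat, e)) <= lsum (pairs M) g.
Proof.
  intros H. destruct M as [|M]; [simpl; lra|].
  unfold pairs in *. rewrite lsum_list_prod. cbn [seq lsum] in *.
  rewrite <- (Rplus_0_r (_ + _)) at 1. apply Rplus_le_compat_l.
  apply lsum_ge0. intros d Hd. apply Rplus_le_le_0_compat.
  - apply H. apply in_prod; [right; exact Hd|left; reflexivity].
  - apply lsum_ge0. intros e He. apply H. apply in_prod; right; assumption.
Qed.

(** Real part of a geometric sum of ratio $re^{ix}$; the factor on the left is $|1 - re^{ix}|^2$.
    The induction uses the three-term recurrence of $\cos(nx)$. *)
Lemma geom_cos_sum r x M :
  ((1 - r) ^ 2 + 2 * r * (1 - cos x)) * lsum (seq 1 M) (fun e => r ^ e * cos (INR e * x)) =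
  r * cos x - r ^ 2 - r ^ S M * cos (INR (S M) * x) + r ^ S (S M) * cos (INR M * x).
Proof.
  induction M as [|M IH].
  - simpl. rewrite Rmult_0_l, Rmult_1_l, cos_0. ring.
  - rewrite lsum_seq_S, Rmult_plus_distr_l, IH.
    assert (E : cos (INR (S (S M)) * x) + cos (INR M * x) = 2 * cos x * cos (INR (S M) * x)).
    { replace (INR (S (S M)) * x) with (INR (S M) * x + x) by (rewrite (S_INR (S M)); ring).
      replace (INR M * x) with (INR (S M) * x - x) by (rewrite S_INR; ring).
      rewrite cos_plus, cos_minus. ring. }
    replace (cos (INR (S (S M)) * x)) with
      (2 * cos x * cos (INR (S M) * x) - cos (INR M * x)) by lra.
    simpl pow. ring.
Qed.

Lemma geom_sum0 r M : r <> 1 ->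
  lsum (seq 1 M) (fun e => r ^ e) = r * (1 - r ^ M) / (1 - r).
Proof.
  intros Hr. induction M as [|M IH]; [simpl; field; lra|].
  rewrite lsum_seq_S, IH. simpl. field. lra.
Qed.

(** The first term is the value of the infinite series, of Poisson kernel type. The tail of $\sum
    r^e$ costs at most $r^M/(1-r)^2$ and the boundary terms of [geom_cos_sum] at most twice that. *)
Lemma kernel_ge r x M : 0 < r < 1 ->
  (1 + r) / (1 - r) * ((1 - cos x) / ((1 - r) ^ 2 / r + 2 * (1 - cos x)))
    - 3 * r ^ M / (1 - r) ^ 2
  <= lsum (seq 1 M) (fun e => r ^ e * (1 - cos (INR e * x))).
Proof.
  intros Hr.
  assert (Hh : 0 <= 1 - cos x) by (pose proof (COS_bound x); lra).
  assert (Hu : 0 < (1 - r) ^ 2) by (apply pow_lt; lra).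
  set (D := (1 - r) ^ 2 + 2 * r * (1 - cos x)).
  assert (HD : (1 - r) ^ 2 <= D) by (unfold D; nra).
  set (c1 := cos (INR (S M) * x)). set (c0 := cos (INR M * x)).
  assert (E : lsum (seq 1 M) (fun e => r ^ e * (1 - cos (INR e * x))) =
    r * (1 - r ^ M) / (1 - r)
    - (r * cos x - r ^ 2 - r ^ S M * c1 + r ^ S (S M) * c0) / D).
  { rewrite (lsum_ext _ _ (fun e => r ^ e + -1 * (r ^ e * cos (INR e * x)))) by (intros; ring).
    rewrite lsum_plus, lsum_scal, geom_sum0 by lra.
    unfold c1, c0, D. rewrite <- geom_cos_sum. fold D. field. split; lra. }
  rewrite E.
  assert (Hc1 : -1 <= c1 <= 1) by apply COS_bound.
  assert (Hc0 : -1 <= c0 <= 1) by apply COS_bound.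
  assert (HrM : 0 < r ^ M) by (apply pow_lt; lra).
  assert (E2 : (1 + r) / (1 - r) * ((1 - cos x) / ((1 - r) ^ 2 / r + 2 * (1 - cos x))) =
    r / (1 - r) - (r * cos x - r ^ 2) / D).
  { unfold D. field. unfold D in HD. split; lra. }
  rewrite E2.
  assert (E3 : r * (1 - r ^ M) / (1 - r) = r / (1 - r) - r * r ^ M / (1 - r)) by (field; lra).
  rewrite E3.
  replace ((r * cos x - r ^ 2 - r ^ S M * c1 + r ^ S (S M) * c0) / D) with
    ((r * cos x - r ^ 2) / D - r ^ M * (r * (c1 - r * c0) / D)) by (simpl; field; lra).
  assert (H1 : r * r ^ M / (1 - r) <= r ^ M / (1 - r) ^ 2).
  { replace (r ^ M / (1 - r) ^ 2) with (1 * r ^ M / (1 - r) ^ 2) by (field; lra).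
    replace (r * r ^ M / (1 - r)) with (r * (1 - r) * r ^ M / (1 - r) ^ 2) by (field; lra).
    apply Rmult_le_compat_r; [left; now apply Rinv_0_lt_compat|].
    apply Rmult_le_compat_r; [lra|nra]. }
  assert (H2 : - (2 / (1 - r) ^ 2) <= r * (c1 - r * c0) / D).
  { apply Rle_trans with (- 2 / D).
    - replace (- (2 / (1 - r) ^ 2)) with (- 2 * / (1 - r) ^ 2) by (field; lra).
      unfold Rdiv. apply Rmult_le_compat_neg_l; [lra|]. apply Rinv_le_contravar; lra.
    - apply Rmult_le_compat_r; [left; apply Rinv_0_lt_compat; lra|]. nra. }
  apply (Rmult_le_compat_l (r ^ M)) in H2; [|lra].
  replace (r ^ M * - (2 / (1 - r) ^ 2)) with (- (2 * (r ^ M / (1 - r) ^ 2))) in H2 by (field; lra).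
  replace (3 * r ^ M / (1 - r) ^ 2) with (3 * (r ^ M / (1 - r) ^ 2)) by (field; lra).
  lra.
Qed.

(** For $r = e^{-t}$, $(1+r)/(1-r) = \coth(t/2) \ge 2/t$, while $(1-r)^2/r = 4\sinh^2(t/2)$ exceeds
    $t^2$ by less than one part in a thousand. *)
Lemma kernel_exp_ge t x M : 0 < t <= 1 / 13 -> 0 < x <= PI ->
  2 / t * ((1 - cos x) / (1001 / 1000 * t ^ 2 + 2 * (1 - cos x)))
    - 3 * exp (- t) ^ M / (1 - exp (- t)) ^ 2
  <= lsum (seq 1 M) (fun e => exp (- t) ^ e * (1 - cos (INR e * x))).
Proof.
  intros Ht Hx. pose proof (exp_neg_lt_1 t (proj1 Ht)) as Hr.
  assert (Ht0 : 0 <= t) by lra.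
  pose proof (exp_neg_ge_taylor t Ht0) as Hlo. pose proof (coth_half_bound t Ht0) as Hc.
  set (r := exp (- t)) in *.
  eapply Rle_trans; [|apply kernel_ge, Hr]. apply Rplus_le_compat_r.
  assert (Hh : 0 < 1 - cos x).
  { assert (cos x < cos 0) by (apply cos_decreasing_1; lra). rewrite cos_0 in *. lra. }
  set (h := 1 - cos x) in *.
  assert (Hu : 0 < (1 - r) ^ 2) by (apply pow_lt; lra).
  assert (Hq0 : 0 < (1 - r) ^ 2 / r) by (apply Rdiv_lt_0_compat; lra).
  assert (Hq : (1 - r) ^ 2 / r <= 1001 / 1000 * t ^ 2).
  { apply Rmult_le_reg_r with r; [lra|].
    replace ((1 - r) ^ 2 / r * r) with ((1 - r) ^ 2) by (field; lra).
    assert (Hlo' : 1 - r <= t * (1 - t / 2 + t ^ 2 / 6)) by lra.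
    apply Rle_trans with (t ^ 2 * (1 - t / 2 + t ^ 2 / 6) ^ 2).
    { rewrite <- Rpow_mult_distr. apply pow_incr. lra. }
    rewrite (Rmult_comm (1001 / 1000)), Rmult_assoc. apply Rmult_le_compat_l; [apply pow2_ge_0|].
    apply Rle_trans with (1001 / 1000 * (1 - t + t ^ 2 / 2 - t ^ 3 / 6)); [|lra].
    assert (t ^ 2 <= 1 / 169) by nra. assert (0 <= t ^ 3) by (apply pow_le; lra).
    assert (0 <= t ^ 2) by apply pow2_ge_0.
    assert (t ^ 3 <= t ^ 2 * (1 / 13)) by (replace (t ^ 3) with (t ^ 2 * t) by ring; apply Rmult_le_compat_l; lra).
    assert (t ^ 4 <= t ^ 2 * (1 / 169)) by (replace (t ^ 4) with (t ^ 2 * t ^ 2) by ring; apply Rmult_le_compat_l; lra).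
    lra. }
  apply Rmult_le_compat.
  - left. apply Rdiv_lt_0_compat; lra.
  - left. apply Rdiv_lt_0_compat; [lra|]. pose proof (pow2_ge_0 t). lra.
  - apply Rmult_le_reg_r with (t * (1 - r)); [apply Rmult_lt_0_compat; lra|].
    replace (2 / t * (t * (1 - r))) with (2 * (1 - r)) by (field; lra).
    replace ((1 + r) / (1 - r) * (t * (1 - r))) with (t * (1 + r)) by (field; lra). lra.
  - apply Rmult_le_compat_l; [lra|]. apply Rinv_le_contravar; lra.
Qed.

(** Keep $e \le L$ and replace $r^e$ by $r^L$. At the saddle point, $L = n$ keeps $r$ away from 1
    and $L = M$ makes $r^M$ tiny. *)
Lemma lsum_seq_ge L M r : (L <= M)%nat -> 0 < r <= 1 ->
  r ^ L * (INR L ^ 2 / 2) <= lsum (seq 1 M) (fun e => INR e * r ^ e).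
Proof.
  intros HLM Hr.
  apply Rle_trans with (lsum (seq 1 L) (fun e => INR e * r ^ e)).
  - clear HLM M.
    assert (H : forall m, (m <= L)%nat -> r ^ L * (INR m ^ 2 / 2) <= lsum (seq 1 m) (fun e => INR e * r ^ e)).
    { induction m as [|m IH]; intros Hm; [simpl; lra|].
      rewrite lsum_seq_S. specialize (IH ltac:(lia)).
      assert (HrL : r ^ L <= r ^ S m).
      { replace L with ((L - S m) + S m)%nat by lia. rewrite pow_add.
        rewrite <- (Rmult_1_l (r ^ S m)) at 2. apply Rmult_le_compat_r; [apply pow_le; lra|].
        rewrite <- (pow1 (L - S m)). apply pow_incr. lra. }
      assert (0 < r ^ L) by (apply pow_lt; lra).
      apply (Rmult_le_compat_l (INR (S m))) in HrL; [|apply pos_INR].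
      rewrite S_INR in *. pose proof (pos_INR m). nra. }
    apply H. lia.
  - replace M with (L + (M - L))%nat by lia. rewrite seq_app, lsum_app.
    rewrite <- (Rplus_0_r (lsum (seq 1 L) _)) at 1. apply Rplus_le_compat_l.
    apply lsum_ge0. intros e _. apply Rmult_le_pos; [apply pos_INR|apply pow_le; lra].
Qed.

(* [moment1_le] gives [t ^ 2 <= 5 k / (3 n)]; the constant 282 turns this into
   [t <= 1 / 13].  The truncation error is at most [24 n ^ 3 / M ^ 2], and we take
   [M = n ^ 3]. *)
Lemma saddle_point (k : R) (n : nat) : 3 <= k -> 282 * k <= INR n ->
  exists (t : R) (M : nat), 0 < t <= 1 / 13 /\ (S n <= M)%nat /\
    lsum (pairs M) (fun de => INR (freq de) * weight k (exp (- t)) de) = INR n /\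
    k * (3 * exp (- t) ^ M / (1 - exp (- t)) ^ 2) <= 1 / 1000.
Proof.
  intros Hk Hn. set (M := (n ^ 3)%nat).
  assert (Hn0 : 846 <= INR n) by lra.
  assert (EM : INR M = INR n ^ 3) by (unfold M; apply pow_INR).
  assert (HnM : (S n <= M)%nat).
  { apply INR_le. rewrite EM, S_INR. simpl. nra. }
  assert (HM : INR n + 1 <= INR M) by (rewrite <- S_INR; now apply le_INR).
  set (F := fun x => lsum (pairs M) (fun de => INR (freq de) * weight k x de)).
  assert (Hlow : forall L x, (L <= M)%nat -> 0 < x <= 1 -> k * (x ^ L * (INR L ^ 2 / 2)) <= F x).
  { intros L x HL Hx. unfold F.
    eapply Rle_trans; [|apply (lsum_pairs_ge (fun de => INR (freq de) * weight k x de))].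
    - rewrite (lsum_ext _ _ (fun e => k * (INR e * x ^ e))).
      + rewrite lsum_scal. apply Rmult_le_compat_l; [lra|]. now apply lsum_seq_ge.
      + intros e _. unfold weight, freq; simpl fst; simpl snd. rewrite Nat.mul_1_l. simpl. field.
    - intros de Hde. apply Rmult_le_pos; [apply pos_INR|].
      left. apply (weight_pos M); [lra|lra|exact Hde]. }
  assert (HF0 : F 0 = 0).
  { unfold F. rewrite (lsum_ext _ _ (fun _ => 0)), ?lsum_const0; [reflexivity|].
    intros de Hde. unfold weight. rewrite pow_i by (apply freq_pos in Hde; lia). ring. }
  assert (HF1 : INR n < F 1).
  { eapply Rlt_le_trans; [|apply (Hlow M 1); [lia|lra]]. rewrite pow1.
    assert (1 * INR M <= INR M ^ 2) by (simpl; nra). nra. }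
  destruct (IVT_cor (fun x => F x - INR n) 0 1) as [x [Hx Ex]].
  - intros x. apply continuity_pt_filterlim.
    apply (ex_derive_continuous (fun x => F x - INR n) x). apply (ex_derive_minus (V := R_NormedModule) F).
    + eexists. apply (is_derive_lsum (pairs M) (fun de x => INR (freq de) * weight k x de)
        (fun de => INR (freq de) * (k / INR (fst de) * (INR (freq de) * x ^ pred (freq de))))).
      intros de. unfold weight. auto_derive; auto. ring.
    + apply ex_derive_const.
  - lra.
  - rewrite HF0. assert (0 <= INR n) by lra. nra.
  - assert (Hx0 : 0 < x < 1).
    { split; apply Rnot_le_lt; intros H.
      - replace x with 0 in Ex by lra. lra.
      - replace x with 1 in Ex by lra. lra. }
    set (t := - ln x).
    assert (Et : exp (- t) = x) by (unfold t; rewrite Ropp_involutive; apply exp_ln; lra).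
    assert (Ht : 0 < t).
    { pose proof (ln_increasing x 1 (proj1 Hx0) (proj2 Hx0)) as Hln.
      rewrite ln_1 in Hln. unfold t. lra. }
    assert (EF : F x = INR n) by lra.
    exists t, M. rewrite Et. repeat split; auto.
    + pose proof (moment1_le k t M ltac:(lra) Ht) as H1. rewrite Et in H1. fold (F x) in H1.
      rewrite EF in H1.
      assert (Ht2 : 0 < t ^ 2) by (apply pow_lt; lra).
      apply (Rmult_le_compat_r (t ^ 2)) in H1; [|lra].
      replace (5 / 3 * k / t ^ 2 * t ^ 2) with (5 / 3 * k) in H1 by (field; lra).
      apply Rnot_lt_le. intros Hgt.
      assert (1 / 169 < t ^ 2) by nra.
      assert (282 * k * t ^ 2 <= INR n * t ^ 2) by (apply Rmult_le_compat_r; lra).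
      assert (282 * k * (1 / 169) < 282 * k * t ^ 2) by (apply Rmult_lt_compat_l; lra).
      lra.
    + pose proof (Hlow n x ltac:(lia) ltac:(lra)) as Hl1.
      pose proof (Hlow M x ltac:(lia) ltac:(lra)) as Hl2.
      rewrite EF in Hl1, Hl2. set (u := 1 - x).
      (* [Hl1] gives $x^n \le 2/(kn)$, which is tiny; Bernoulli's inequality $1 - nu \le x^n$ then
         bounds $u$ from below. *)
      assert (Hu : 1 / 2 <= INR n * u).
      { assert (Hxn : 1 - INR n * u <= x ^ n).
        { destruct n as [|n']; [simpl; lra|].
          replace x with (1 + - u) by (unfold u; ring).
          assert (Hb' : forall m, 1 - INR m * u <= (1 + - u) ^ m).
          { induction m as [|m IH]; [simpl; lra|].
            rewrite S_INR. simpl. apply (Rmult_le_compat_l (1 + - u)) in IH; [|unfold u; lra].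
            assert (0 <= INR m * (u * u)) by (apply Rmult_le_pos; [apply pos_INR|apply Rle_0_sqr]).
            lra. }
          apply Hb'. }
        assert (k * (x ^ n * INR n) <= 2).
        { apply Rmult_le_reg_l with (INR n); [lra|]. lra. }
        assert (0 < x ^ n) by (apply pow_lt; lra).
        assert (x ^ n * 846 <= x ^ n * INR n) by (apply Rmult_le_compat_l; lra).
        assert (3 * (x ^ n * INR n) <= k * (x ^ n * INR n)) by (apply Rmult_le_compat_r; lra).
        lra. }
      assert (Hu0 : 0 < u) by (unfold u; lra).
      assert (Hu2 : 0 < u ^ 2) by (apply pow_lt; lra).
      rewrite EM in Hl2.
      apply Rmult_le_reg_r with (u ^ 2); [lra|].
      replace (k * (3 * x ^ M / u ^ 2) * u ^ 2) with (3 * (k * x ^ M)) by (field; lra).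
      set (N := INR n) in *.
      assert (HN3 : 0 < N ^ 3) by (apply pow_lt; lra).
      assert (Hk1 : k * x ^ M * N ^ 5 <= 2).
      { apply Rmult_le_reg_l with N; [lra|].
        replace (N * (k * x ^ M * N ^ 5)) with (2 * (k * (x ^ M * ((N ^ 3) ^ 2 / 2)))) by field. lra. }
      assert (H4 : 1 / 4 <= N ^ 2 * u ^ 2).
      { replace (N ^ 2 * u ^ 2) with ((N * u) ^ 2) by ring. replace (1 / 4) with ((1 / 2) ^ 2) by field.
        apply pow_incr. lra. }
      assert (HN2 : 0 < N ^ 2) by (apply pow_lt; lra).
      assert (HN3' : 846 ^ 3 <= N ^ 3) by (apply pow_incr; lra).
      assert (Hkx : 0 < k * x ^ M) by (apply Rmult_lt_0_compat; [lra|apply pow_lt; lra]).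
      assert (H5 : (k * x ^ M) * N ^ 2 * 846 ^ 3 <= 2).
      { apply Rle_trans with (k * x ^ M * N ^ 2 * N ^ 3); [|lra].
        apply Rmult_le_compat_l; [|lra]. apply Rmult_le_pos; lra. }
      apply Rmult_le_reg_l with (N ^ 2); [lra|]. lra.
Qed.

(** Both sides obey the same recurrence, since $de \cdot (k/d)\, r^{de} = k e\, r^{de}$; the terms
    with $de > j$ vanish by [fourier_neg] and the initial value is [fourier_0]. *)
Lemma fourier_weight (k r : R) (p : nat -> R) (M : nat) : p O = 1 ->
  (forall j, (1 <= j <= M)%nat -> INR j * p j = k * lsum (pairs M) (fun de =>
     if (freq de <=? j)%nat then INR (snd de) * p (j - freq de)%nat else 0)) ->
  forall j, (j <= M)%nat ->
    fourier (pairs M) (weight k r) freq (Z.of_nat j) = PI * (p j * r ^ j).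
Proof.
  intros Hp0 Hrec j. induction j as [j IH] using (well_founded_induction lt_wf). intros HjM.
  destruct (Nat.eq_dec j 0) as [->|Hj].
  - rewrite fourier_0, Hp0 by (intros de; apply freq_pos). simpl. ring.
  - apply Rmult_eq_reg_l with (INR j); [|now apply not_0_INR].
    rewrite (INR_IZR_INZ j) at 1. rewrite <- fourier_recurrence.
    transitivity (PI * r ^ j * (INR j * p j)); [|ring].
    rewrite Hrec by lia. rewrite <- !lsum_scal.
    apply lsum_ext. intros [d e] Hde. pose proof (freq_pos M _ Hde) as Hf.
    apply in_pairs in Hde. set (f := freq (d, e)) in *.
    assert (Hd : INR d <> 0) by (apply not_0_INR; lia).
    assert (Ef : INR f = INR d * INR e) by apply mult_INR.
    destruct (Nat.leb_spec f j) as [H|H].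
    + replace (Z.of_nat j - Z.of_nat f)%Z with (Z.of_nat (j - f)) by lia.
      rewrite IH by lia. unfold weight. fold f. simpl fst; simpl snd.
      replace (r ^ j) with (r ^ f * r ^ (j - f)) by (rewrite <- pow_add; f_equal; lia).
      rewrite Ef. field. exact Hd.
    + rewrite fourier_neg; [ring|intros de; apply freq_pos|lia].
Qed.

(* Positivity of [2 p_n - r p_(n+1) - p_(n-1) / r] for one [r] is enough, by AM-GM. *)
Lemma log_concave_of_recurrence (k : R) (p : nat -> R) (n : nat) :
  3 <= k -> 282 * k <= INR n -> p O = 1 -> (forall j, 0 <= p j) ->
  (forall M j, (1 <= j <= M)%nat -> INR j * p j = k * lsum (pairs M) (fun de =>
     if (freq de <=? j)%nat then INR (snd de) * p (j - freq de)%nat else 0)) ->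
  p (n - 1)%nat * p (S n) < p n ^ 2.
Proof.
  intros Hk Hn Hp0 Hpos Hrec.
  destruct (saddle_point k n Hk Hn) as [t [M [Ht [HnM [Hmean Herr]]]]].
  set (r := exp (- t)) in *. pose proof (exp_neg_lt_1 t (proj1 Ht)) as Hr. fold r in Hr.
  set (l := pairs M). set (w := weight k r).
  assert (Hw : forall de, In de l -> 0 < w de) by (intros; apply (weight_pos M); auto; lra).
  assert (Ht3 : 0 < t ^ 3) by (apply pow_lt; lra).
  (* $1/s^2$ is the bound $10k/(3t^3)$ of [moment2_le] for the second moment; $k \ge 3$ gives $10
     s^2 \le t^3$. *)
  set (s := sqrt (3 / 10 * t ^ 3 / k)).
  assert (Hs2 : s ^ 2 = 3 / 10 * t ^ 3 / k).
  { unfold s. rewrite pow2_sqrt; [reflexivity|]. left. apply Rdiv_lt_0_compat; lra. }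
  assert (Hs : 0 < s) by (apply sqrt_lt_R0, Rdiv_lt_0_compat; lra).
  set (V := fun x => lsum l (fun de => w de * (1 - cos (INR (freq de) * x)))).
  set (X := fun x => im_poly l w freq x - INR n * x).
  assert (Hre : forall x, re_poly l w freq x = lsum l w + - V x).
  { intros x. unfold re_poly, V.
    replace (- lsum l _) with (-1 * lsum l (fun de => w de * (1 - cos (INR (freq de) * x)))) by ring.
    rewrite <- lsum_scal, <- lsum_plus. apply lsum_ext. intros; ring. }
  assert (Hex : forall a b, ex_RInt (fun x => exp (- V x) * cos (X x) * (1 - cos x)) a b).
  { intros a b. apply (@ex_RInt_continuous R_CompleteNormedModule). intros z _.
    apply (ex_derive_continuous (fun x => exp (- V x) * cos (X x) * (1 - cos x))).
    assert (HV' : ex_derive V z).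
    { eexists. apply (is_derive_lsum l (fun de x => w de * (1 - cos (INR (freq de) * x)))
        (fun de => w de * (INR (freq de) * sin (INR (freq de) * z)))).
      intros de. auto_derive; auto. ring. }
    assert (HX' : ex_derive X z).
    { apply (ex_derive_minus (V := R_NormedModule) (im_poly l w freq)).
      - eexists. apply is_derive_im_poly.
      - auto_derive. auto. }
    auto_derive. auto. }
  pose proof (oscillatory_pos V X t s Ht Hs) as Hosc.
  assert (Hint : 0 < RInt (fun x => exp (- V x) * cos (X x) * (1 - cos x)) 0 PI).
  { apply Hosc; clear Hosc.
    - rewrite Hs2. apply Rmult_le_reg_r with k; [lra|].
      replace (10 * (3 / 10 * t ^ 3 / k) * k) with (3 * t ^ 3) by (field; lra). nra.
    - exact Hex.
    - intros x Hx. rewrite Hs2.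
      apply Rle_trans with (lsum l (fun de => x ^ 2 / 2 * (INR (freq de) ^ 2 * w de))).
      + apply lsum_le. intros de Hde. specialize (Hw de Hde).
        pose proof (cos_ge (INR (freq de) * x)) as Hc. rewrite Rpow_mult_distr in Hc. nra.
      + rewrite lsum_scal. pose proof (moment2_le k t M ltac:(lra) (proj1 Ht)) as H2.
        fold r w l in H2.
        apply Rle_trans with (x ^ 2 / 2 * (10 / 3 * k / t ^ 3)).
        * apply Rmult_le_compat_l; [pose proof (pow2_ge_0 x); lra|exact H2].
        * right. field. split; lra.
    - intros x Hx. rewrite Hs2.
      apply Rle_trans with (lsum l (fun de => x ^ 3 / 6 * (INR (freq de) ^ 3 * w de))).
      + replace (X x) with (lsum l (fun de => w de * (sin (INR (freq de) * x) - INR (freq de) * x))).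
        * eapply Rle_trans; [apply lsum_abs|]. apply lsum_le. intros de Hde. specialize (Hw de Hde).
          rewrite Rabs_mult, (Rabs_pos_eq (w de)) by lra.
          assert (0 <= INR (freq de) * x) as H0 by (apply Rmult_le_pos; [apply pos_INR|lra]).
          apply Rabs_sin_sub_id in H0. rewrite Rpow_mult_distr in H0.
          apply (Rmult_le_compat_l (w de)) in H0; lra.
        * unfold X, im_poly. rewrite <- Hmean.
          replace (lsum l (fun i => w i * sin (INR (freq i) * x)) - _) with
            (lsum l (fun i => w i * sin (INR (freq i) * x)) +
             - x * lsum l (fun de => INR (freq de) * w de)) by (unfold l, w; ring).
          rewrite <- lsum_scal, <- lsum_plus. apply lsum_ext. intros; ring.
      + rewrite lsum_scal. pose proof (moment3_le k t M ltac:(lra) (proj1 Ht)) as H3.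
        fold r w l in H3.
        apply Rle_trans with (x ^ 3 / 6 * (102 / 10 * k / t ^ 4)).
        * apply Rmult_le_compat_l; [|exact H3]. apply Rmult_le_pos; [apply pow_le|]; lra.
        * right. field. split; lra.
    - intros x Hx. rewrite Hs2.
      eapply Rle_trans; [|apply (lsum_pairs_ge (fun de => w de * (1 - cos (INR (freq de) * x))))].
      + rewrite (lsum_ext _ _ (fun e => k * (r ^ e * (1 - cos (INR e * x))))).
        * rewrite lsum_scal. pose proof (kernel_exp_ge t x M Ht Hx) as HK. fold r in HK.
          apply (Rmult_le_compat_l k) in HK; [|lra]. rewrite Rmult_minus_distr_l in HK.
          replace (6 / 10 * t ^ 2 / (3 / 10 * t ^ 3 / k)) with (k * (2 / t)) by (field; lra).
          rewrite <- Rmult_assoc in HK. lra.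
        * intros e _. unfold w, weight, freq; simpl fst; simpl snd. rewrite Nat.mul_1_l. simpl. field.
      + intros de Hde. specialize (Hw de Hde). pose proof (COS_bound (INR (freq de) * x)).
        apply Rmult_le_pos; lra. }
  assert (Hn1 : (1 <= n)%nat) by (apply INR_le; simpl; lra).
  set (J := fourier l w freq).
  (* The neighbouring phases are $X \mp x$ and $\cos(X-x) + \cos(X+x) = 2\cos X \cos x$, which
     yields the factor $1 - \cos x$. *)
  assert (HJ : 0 < 2 * J (Z.of_nat n) - J (Z.of_nat (S n)) - J (Z.of_nat (n - 1))).
  { assert (E : is_RInt (fun x => scal (2 * exp (lsum l w)) (exp (- V x) * cos (X x) * (1 - cos x))) 0 PI
      (2 * J (Z.of_nat n) - J (Z.of_nat (S n)) - J (Z.of_nat (n - 1)))).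
    { eapply is_RInt_ext with (f := fun x => minus (minus (scal 2 (mode l w freq (Z.of_nat n) x))
        (mode l w freq (Z.of_nat (S n)) x)) (mode l w freq (Z.of_nat (n - 1)) x)).
      - intros x _. unfold mode. rewrite Hre, exp_plus. rewrite <- !INR_IZR_INZ.
        replace (im_poly l w freq x - INR (S n) * x) with (X x - x) by (unfold X; rewrite S_INR; ring).
        replace (im_poly l w freq x - INR (n - 1) * x) with (X x + x)
          by (unfold X; rewrite minus_INR by exact Hn1; simpl; ring).
        fold (X x). rewrite cos_plus, cos_minus.
        unfold minus, plus, opp, scal; simpl; unfold mult; simpl.
        match goal with |- ?a = ?b => change (@eq R a b) end. ring.
      - apply (is_RInt_minus (V := R_NormedModule)); [apply (is_RInt_minus (V := R_NormedModule))|].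
        + apply (is_RInt_scal (V := R_NormedModule)).
          apply (RInt_correct (V := R_CompleteNormedModule)), ex_RInt_mode.
        + apply (RInt_correct (V := R_CompleteNormedModule)), ex_RInt_mode.
        + apply (RInt_correct (V := R_CompleteNormedModule)), ex_RInt_mode. }
    rewrite <- (is_RInt_unique _ _ _ _ E).
    rewrite (RInt_scal (V := R_CompleteNormedModule)) by apply Hex.
    apply Rmult_lt_0_compat; [|exact Hint].
    pose proof (exp_pos (lsum l w)). lra. }
  assert (HJE : forall j, (j <= M)%nat -> J (Z.of_nat j) = PI * (p j * r ^ j)).
  { intros j Hj. apply fourier_weight; auto. }
  rewrite !HJE in HJ by lia.
  assert (Hrn : 0 < r ^ (n - 1)) by (apply pow_lt; lra).
  replace (r ^ S n) with (r ^ 2 * r ^ (n - 1)) in HJ by (rewrite <- pow_add; f_equal; lia).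
  replace (r ^ n) with (r * r ^ (n - 1)) in HJ by (rewrite tech_pow_Rmult; f_equal; lia).
  pose proof PI_RGT_0 as Hpi.
  assert (Hlin : p (S n) * r ^ 2 + p (n - 1)%nat < 2 * (p n * r)).
  { apply Rmult_lt_reg_l with (PI * r ^ (n - 1)); [now apply Rmult_lt_0_compat|]. lra. }
  pose proof (Hpos n). pose proof (Hpos (S n)). pose proof (Hpos (n - 1)%nat).
  set (a := p (S n)) in *. set (b := p (n - 1)%nat) in *. set (c := p n) in *.
  assert (Hr2 : 0 < r ^ 2) by (apply pow_lt; lra).
  assert (0 <= a * r ^ 2) by (apply Rmult_le_pos; lra).
  assert (Hsq : (a * r ^ 2 + b) ^ 2 < (2 * (c * r)) ^ 2) by (simpl; nra).
  pose proof (pow2_ge_0 (a * r ^ 2 - b)).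
  apply Rmult_lt_reg_r with (4 * r ^ 2); [lra|]. lra.
Qed.

(** [nsum] and [nprod] are the interface between the analysis, which sums over Stdlib lists, and the
    big operators of the statement; their indices run from 1. *)
Definition nsum (M : nat) (g : nat -> nat) : nat := list_sum (map g (seq 1 M)).

Definition nprod (M : nat) (g : nat -> nat) : nat := fold_right Nat.mul 1%nat (map g (seq 1 M)).

Lemma INR_list_sum (l : list nat) (g : nat -> nat) :
  INR (list_sum (map g l)) = lsum l (fun i => INR (g i)).
Proof. induction l as [|a l IH]; simpl; [reflexivity|now rewrite plus_INR, IH]. Qed.

Lemma log_concave_of_nat_recurrence (k : nat) (f : nat -> nat) (n : nat) :
  (3 <= k)%nat -> (282 * k <= n)%nat -> f O = 1%nat ->
  (forall M j, (1 <= j <= M)%nat -> (j * f j = k * nsum M (fun d => nsum M (fun e =>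
     if (d * e <=? j)%nat then e * f (j - d * e) else 0)))%nat) ->
  (f (n - 1) * f (S n) < f n * f n)%nat.
Proof.
  intros Hk Hn Hf0 Hrec. apply INR_lt. rewrite !mult_INR.
  replace (INR (f n) * INR (f n)) with (INR (f n) ^ 2) by ring.
  apply (log_concave_of_recurrence (INR k) (fun j => INR (f j))).
  - apply le_INR in Hk. simpl in Hk. lra.
  - apply le_INR in Hn. rewrite mult_INR in Hn. replace 282 with (INR 282) by (simpl; ring). exact Hn.
  - now rewrite Hf0.
  - intros j. apply pos_INR.
  - intros M j Hj. rewrite <- mult_INR, Hrec with (M := M) by exact Hj. rewrite mult_INR.
    f_equal. unfold nsum, pairs. rewrite INR_list_sum, lsum_list_prod. apply lsum_ext. intros d _.
    rewrite INR_list_sum. apply lsum_ext. intros e _. unfold freq; simpl fst; simpl snd.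
    destruct (d * e <=? j)%nat; [apply mult_INR|reflexivity].
Qed.

(** * Majorization *)

Lemma nprod_pos (r : nat) (g : nat -> nat) :
  (forall j, (0 < g j)%nat) -> (0 < nprod r g)%nat.
Proof.
  intros H. unfold nprod. induction (seq 1 r) as [|a l IH]; simpl; [lia|].
  specialize (H a). nia.
Qed.

Lemma ln_nprod (r : nat) (g : nat -> nat) : (forall j, (0 < g j)%nat) ->
  ln (INR (nprod r g)) = lsum (seq 1 r) (fun j => ln (INR (g j))).
Proof.
  intros H. unfold nprod.
  enough (Hl : forall l, (0 < fold_right Nat.mul 1 (map g l))%nat /\
    ln (INR (fold_right Nat.mul 1%nat (map g l))) = lsum l (fun j => ln (INR (g j)))) by apply Hl.
  induction l as [|a l [IH1 IH2]]; simpl; [split; [lia|apply ln_1]|]. specialize (H a).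
  split; [nia|]. rewrite mult_INR, ln_mult, IH2 by (now apply lt_0_INR). reflexivity.
Qed.

(** Summation by parts. The induction carries the stronger claim that each partial sum is at most
    the current slope times the partial sum of [d]. *)
Lemma abel_le0 (c d : nat -> R) (r : nat) :
  (forall j, (1 <= j < r)%nat -> c (S j) <= c j) ->
  (forall m, (1 <= m < r)%nat -> lsum (seq 1 m) d <= 0) ->
  lsum (seq 1 r) d = 0 ->
  lsum (seq 1 r) (fun j => c j * d j) <= 0.
Proof.
  intros Hc Hd Hr. destruct r as [|r]; [simpl; lra|].
  assert (H : forall m, (m <= r)%nat ->
    lsum (seq 1 (S m)) (fun j => c j * d j) <= c (S m) * lsum (seq 1 (S m)) d).
  { induction m as [|m IH]; intros Hm; [simpl; lra|].
    rewrite (lsum_seq_S _ (S m)), (lsum_seq_S d (S m)).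
    specialize (IH ltac:(lia)). specialize (Hc (S m) ltac:(lia)). specialize (Hd (S m) ltac:(lia)).
    nra. }
  specialize (H r (le_n _)). rewrite Hr in H. lra.
Qed.

Lemma concave_slope (g : nat -> R) (i m : nat) :
  (forall n, (2 <= n)%nat -> g (S n) - g n < g n - g (n - 1)%nat) ->
  (1 <= i)%nat -> g (S (i + m)) - g (i + m)%nat <= g (S i) - g i.
Proof.
  intros Hg Hi. induction m as [|m IH]; [rewrite Nat.add_0_r; lra|].
  specialize (Hg (i + S m)%nat ltac:(lia)).
  replace (i + S m - 1)%nat with (i + m)%nat in Hg by lia.
  replace (S (i + m)) with (i + S m)%nat in IH by lia. lra.
Qed.

(** The forward slope at [y] serves as tangent. It is attained at $x = y + 1$, so strictness is
    claimed only to the left of [y]. *)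
Lemma concave_tangent (g : nat -> R) (x y : nat) :
  (forall n, (2 <= n)%nat -> g (S n) - g n < g n - g (n - 1)%nat) ->
  (1 <= x)%nat -> (1 <= y)%nat ->
  g x - g y <= (g (S y) - g y) * (INR x - INR y) /\
  ((x < y)%nat -> g x - g y < (g (S y) - g y) * (INR x - INR y)).
Proof.
  intros Hg Hx Hy.
  pose proof (fun m i => concave_slope g i m Hg) as Hdec.
  assert (Hup : forall m, g (y + m)%nat - g y <= (g (S y) - g y) * INR m).
  { induction m as [|m IH]; [rewrite Nat.add_0_r; simpl; lra|].
    rewrite S_INR. pose proof (Hdec m y Hy).
    replace (y + S m)%nat with (S (y + m)) by lia. lra. }
  assert (Hdown : forall m, (1 <= m)%nat -> (S m <= y)%nat ->
    g (y - m)%nat - g y < (g (S y) - g y) * - INR m).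
  { induction m as [|m IH]; intros Hm Hmy; [lia|].
    assert (H : g (S y) - g y < g (y - m)%nat - g (y - S m)%nat).
    { pose proof (Hg (y - m)%nat ltac:(lia)) as H1.
      pose proof (Hdec m (y - m)%nat ltac:(lia)) as H2.
      replace (y - m + m)%nat with y in H2 by lia.
      replace (y - m - 1)%nat with (y - S m)%nat in H1 by lia. lra. }
    destruct (Nat.eq_dec m 0) as [->|Hm0].
    - rewrite Nat.sub_0_r in H. simpl INR. lra.
    - specialize (IH ltac:(lia) ltac:(lia)). rewrite S_INR. lra. }
  destruct (le_lt_dec y x) as [H|H].
  - split; [|lia]. specialize (Hup (x - y)%nat). rewrite minus_INR in Hup by lia.
    replace (y + (x - y))%nat with x in Hup by lia. exact Hup.
  - specialize (Hdown (y - x)%nat ltac:(lia) ltac:(lia)). rewrite minus_INR in Hdown by lia.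
    replace (y - (y - x))%nat with x in Hdown by lia.
    replace (- (INR y - INR x)) with (INR x - INR y) in Hdown by ring. split; intros; lra.
Qed.

Lemma lsum_lt {A} (l : list A) (g h : A -> R) (a : A) :
  (forall x, In x l -> g x <= h x) -> In a l -> g a < h a -> lsum l g < lsum l h.
Proof.
  induction l as [|b l IH]; simpl; intros H Ha Hlt; [tauto|].
  destruct Ha as [->|Ha].
  - apply Rplus_lt_le_compat; [exact Hlt|]. apply lsum_le. auto.
  - apply Rplus_le_lt_compat; auto.
Qed.

(* Karamata's inequality: as [y] increases, the slopes of the tangents at the
   [y j] decrease, and Abel summation applies. *)
Lemma nprod_lt_of_majorizes (f : nat -> nat) (x y : nat -> nat) (r : nat) :
  (forall n, (0 < f n)%nat) ->
  (forall n, (2 <= n)%nat -> (f (n - 1) * f (S n) < f n * f n)%nat) ->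
  (forall j, (1 <= j <= r)%nat -> (1 <= x j)%nat) ->
  (forall j, (1 <= j <= r)%nat -> (1 <= y j)%nat) ->
  (forall j, (1 <= j < r)%nat -> (y j <= y (S j))%nat) ->
  (forall m, (1 <= m < r)%nat -> (nsum m x <= nsum m y)%nat) ->
  nsum r x = nsum r y ->
  (exists j, (1 <= j <= r)%nat /\ x j <> y j) ->
  (nprod r (fun j => f (x j)) < nprod r (fun j => f (y j)))%nat.
Proof.
  intros Hf Hlc Hx Hy Hmon Hmaj Htot Hneq.
  set (g := fun n => ln (INR (f n))).
  assert (Hg : forall n, (2 <= n)%nat -> g (S n) - g n < g n - g (n - 1)%nat).
  { intros n Hn. specialize (Hlc n Hn). apply lt_INR in Hlc. rewrite !mult_INR in Hlc.
    pose proof (lt_0_INR _ (Hf n)). pose proof (lt_0_INR _ (Hf (S n))).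
    pose proof (lt_0_INR _ (Hf (n - 1)%nat)).
    apply ln_increasing in Hlc; [|now apply Rmult_lt_0_compat].
    rewrite !ln_mult in Hlc by assumption. unfold g. lra. }
  set (c := fun j => g (S (y j)) - g (y j)).
  set (d := fun j => INR (x j) - INR (y j)).
  assert (Hd : forall m, lsum (seq 1 m) d = INR (nsum m x) - INR (nsum m y)).
  { intros m. unfold nsum, d. rewrite !INR_list_sum.
    rewrite (lsum_ext _ _ (fun j => INR (x j) + -1 * INR (y j))) by (intros; ring).
    rewrite lsum_plus, lsum_scal. ring. }
  assert (Habel : lsum (seq 1 r) (fun j => c j * d j) <= 0).
  { apply abel_le0.
    - intros j Hj. specialize (Hmon j Hj). unfold c.
      replace (y (S j)) with (y j + (y (S j) - y j))%nat by lia.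
      apply (concave_slope g); [exact Hg|]. apply Hy. lia.
    - intros m Hm. rewrite Hd. specialize (Hmaj m Hm). apply le_INR in Hmaj. lra.
    - rewrite Hd, Htot. ring. }
  (* The strict tangent bound requires an index of this sign; equal totals and distinct tuples
     provide one. *)
  assert (Hlt : exists j, (1 <= j <= r)%nat /\ (x j < y j)%nat).
  { destruct Hneq as [j0 [Hj0 Hne]].
    destruct (Exists_dec (fun j => (x j < y j)%nat) (seq 1 r)) as [He|He].
    - intros j. apply lt_dec.
    - apply Exists_exists in He. destruct He as [j [Hj%in_seq Hjl]]. exists j. split; [lia|exact Hjl].
    - exfalso. assert (Hge : forall j, In j (seq 1 r) -> INR (y j) <= INR (x j)).
      { intros j Hj. apply le_INR. destruct (le_lt_dec (y j) (x j)) as [H|H]; [exact H|].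
        exfalso. apply He, Exists_exists. now exists j. }
      assert (Hin : In j0 (seq 1 r)) by (apply in_seq; lia).
      assert (lsum (seq 1 r) (fun j => INR (y j)) < lsum (seq 1 r) (fun j => INR (x j))).
      { apply lsum_lt with j0; [exact Hge|exact Hin|].
        specialize (Hge j0 Hin). apply INR_le in Hge. apply lt_INR. lia. }
      apply (f_equal INR) in Htot. unfold nsum in Htot. rewrite !INR_list_sum in Htot. lra. }
  destruct Hlt as [j1 [Hj1 Hlt]].
  assert (Hsum : lsum (seq 1 r) (fun j => g (x j)) < lsum (seq 1 r) (fun j => g (y j))).
  { assert (lsum (seq 1 r) (fun j => g (x j) + -1 * g (y j)) < lsum (seq 1 r) (fun j => c j * d j)).
    { apply lsum_lt with j1.
      - intros j Hj%in_seq.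
        destruct (concave_tangent g (x j) (y j) Hg (Hx j ltac:(lia)) (Hy j ltac:(lia))) as [H _].
        unfold c, d. lra.
      - apply in_seq. lia.
      - destruct (concave_tangent g (x j1) (y j1) Hg (Hx j1 ltac:(lia)) (Hy j1 ltac:(lia))) as [_ H].
        specialize (H Hlt). unfold c, d. lra. }
    rewrite lsum_plus, lsum_scal in H. lra. }
  unfold g in Hsum. rewrite <- (ln_nprod r (fun j => f (x j))), <- (ln_nprod r (fun j => f (y j))) in Hsum
    by (intros; apply Hf).
  apply INR_lt. apply ln_lt_inv; [| |exact Hsum]; apply lt_0_INR, nprod_pos; intros; apply Hf.
Qed.

Local Close Scope R_scope.

From mathcomp Require Import all_boot all_order all_algebra.
From mathcomp Require Import ring lra zify ssrZ.

Set Implicit Arguments.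
Unset Strict Implicit.
Unset Printing Implicit Defensive.

Import Order.TTheory GRing.Theory Num.Theory.

Local Open Scope ring_scope.

(** * Generating functions *)

Definition euler_poly N : {poly int} := \prod_(j < N) (1 - 'X^(j.+1)).

Definition pk_poly k N : {poly int} := \sum_(m < N.+1) (pk k m)%:R *: 'X^m.

Local Notation "p == q %[trunc N ]" := (Defs.eqX N.+1 p q)
  (at level 70, q at next level, format "p  ==  q  %[trunc  N ]").

Lemma eqX_sym N (p q : {poly int}) : p == q %[trunc N] -> q == p %[trunc N].
Proof. by move=> h i hi; rewrite h. Qed.

Lemma eqX_trans N (p q s : {poly int}) :
  p == q %[trunc N] -> q == s %[trunc N] -> p == s %[trunc N].
Proof. by move=> h1 h2 i hi; rewrite h1 ?h2. Qed.

Lemma eqXD N (p p' q q' : {poly int}) :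
  p == p' %[trunc N] -> q == q' %[trunc N] -> p + q == p' + q' %[trunc N].
Proof. by move=> h1 h2 i hi; rewrite !coefD h1 ?h2. Qed.

Lemma eqXMl N (s p q : {poly int}) : p == q %[trunc N] -> s * p == s * q %[trunc N].
Proof. exact: Defs.eqXM. Qed.

Lemma eqXMr N (s p q : {poly int}) : p == q %[trunc N] -> p * s == q * s %[trunc N].
Proof. by move=> h; apply: Defs.eqXM. Qed.

Lemma coef_pk_poly k N i : (i <= N)%N -> (pk_poly k N)`_i = (pk k i)%:R.
Proof.
by move=> hi; rewrite /pk_poly -(poly_def N.+1 (fun m => (pk k m)%:R)) coef_poly ltnS hi.
Qed.

Lemma pk_poly_euler k N : pk_poly k N * euler_poly N ^+ k == 1 %[trunc N].
Proof.
move=> i hi; rewrite /euler_poly -prodrXl.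
by rewrite (pk_generating_function k (N := N)) // coef1.
Qed.
Arguments pk_poly_euler : clear implicits.

(** With $E$ the Euler product, insert $AE^k = 1$ and $BE^l = 1$ into $C$, regroup, and remove
    $CE^{k+l} = 1$. *)
Lemma pk_polyD k l N : pk_poly (k + l) N == pk_poly k N * pk_poly l N %[trunc N].
Proof.
set A := pk_poly k N; set B := pk_poly l N; set C := pk_poly (k + l) N.
have hC : C == C * (A * euler_poly N ^+ k) * (B * euler_poly N ^+ l) %[trunc N].
  apply: eqX_sym; apply: eqX_trans (eqXMl _ (pk_poly_euler l N)) _.
  by rewrite mulr1; apply: eqX_trans (eqXMl _ (pk_poly_euler k N)) _; rewrite mulr1.
apply: eqX_trans hC _.
have -> : C * (A * euler_poly N ^+ k) * (B * euler_poly N ^+ l) =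
    A * B * (C * euler_poly N ^+ (k + l)).
  by rewrite exprD; move: (_ ^+ k) (_ ^+ l) => a b; ring.
by rewrite -[X in Defs.eqX _ _ X]mulr1; apply: eqXMl; apply: pk_poly_euler.
Qed.
Arguments pk_polyD : clear implicits.

Lemma pkD k l n : pk (k + l) n = (\sum_(i < n.+1) pk k i * pk l (n - i))%N.
Proof.
apply/eqP; rewrite -(eqr_nat int) natr_sum.
rewrite -(@coef_pk_poly _ n) // pk_polyD // coefM; apply/eqP/eq_bigr => i _.
by rewrite !coef_pk_poly ?natrM ?leq_subr // -ltnS.
Qed.

Lemma pk0 n : pk 0 n = (n == 0)%N.
Proof.
apply/eqP; rewrite -(eqr_nat int) -(@coef_pk_poly _ n) //.
by have := pk_poly_euler 0 n; rewrite expr0 mulr1 => -> //; rewrite coef1.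
Qed.

Lemma pk_at0 k : pk k 0 = 1%N.
Proof.
apply/eqP; rewrite -(eqr_nat int) -(@coef_pk_poly _ 0) //.
by have := pk_poly_euler k 0; rewrite /euler_poly big_ord0 expr1n mulr1 => -> //; rewrite coef1.
Qed.

(** Multiplication by the Euler product removes one colour. Read backwards, this recurrence computes
    the next colour in the verification of small cases. *)
Lemma pkS_euler k N n : (n <= N)%N ->
  (\sum_(i < n.+1) (euler_poly N)`_i * (pk k.+1 (n - i))%:R) = (pk k n)%:R :> int.
Proof.
move=> hn.
have h : pk_poly k.+1 N * euler_poly N == pk_poly k N %[trunc N].
  apply: eqX_trans (eqXMr _ (_ : _ == pk_poly k N * pk_poly 1 N %[trunc N])) _.
    by rewrite -(addn1 k); apply: pk_polyD.
  rewrite -mulrA -[X in Defs.eqX _ _ X]mulr1; apply: eqXMl.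
  exact: (pk_poly_euler 1).
rewrite -(@coef_pk_poly k N) // -h ?ltnS // mulrC coefM; apply: eq_bigr => i _.
by rewrite coef_pk_poly // (leq_trans (leq_subr _ _)).
Qed.

(* [A] and [T] satisfy [log_rel N A T] when the logarithmic derivative
   [X A' / A] agrees with [- T] up to degree [N]. *)
Definition log_rel N (A T : {poly int}) := 'X * A^`() == - (A * T) %[trunc N].

Lemma log_relM N (A B S T : {poly int}) :
  log_rel N A S -> log_rel N B T -> log_rel N (A * B) (S + T).
Proof.
move=> hA hB; rewrite /log_rel derivM mulrDr.
have -> : - (A * B * (S + T)) = - (A * S) * B + A * - (B * T).
  by ring.
apply: eqXD; first by rewrite mulrA; apply: eqXMr.
by rewrite mulrCA; apply: eqXMl.
Qed.

(** Truncation of the Lambert series $\sum_e e q^e/(1-q^e)$, whose coefficient at $q^n$ is the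
    divisor sum $\sigma(n)$. *)
Definition lambert N : {poly int} :=
  \sum_(e < N) \sum_(d < N) (e.+1)%:R *: 'X^(d.+1 * e.+1).

Lemma log_rel_euler N : log_rel N (euler_poly N) (lambert N).
Proof.
apply: (big_ind2 (log_rel N)) => [|A S B T|e _].
- by move=> i _; rewrite -[in X in X^`()]polyC1 derivC !mulr0 oppr0.
- exact: log_relM.
rewrite /log_rel.
have -> : 'X * (1 - 'X^(e.+1))^`() = - ((e.+1)%:R *: 'X^(e.+1)) :> {poly int}.
  by rewrite derivB derivXn derivC sub0r mulrN mulrnAr -exprS scaler_nat.
move=> i hi; rewrite -scaler_sumr -scalerAr !coefN !coefZ; congr (- (_ * _)).
(* The geometric sum telescopes, and its last term has degree above [N]. *)
have -> : (1 - 'X^(e.+1)) * (\sum_(d < N) 'X^(d.+1 * e.+1)) =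
    'X^(e.+1) - 'X^(N.+1 * e.+1) :> {poly int}.
  rewrite mulrBl mul1r mulr_sumr.
  under [X in _ - X]eq_bigr do rewrite -exprD -mulSn.
  have := telescope_sumr (fun d => 'X^(d.+1 * e.+1) : {poly int}) (leq0n N).
  rewrite mul1n sumrB !big_mkord => h.
  by apply: oppr_inj; rewrite opprB h opprB.
rewrite coefB !coefXn; have /negbTE -> : (i != N.+1 * e.+1)%N.
  by rewrite neq_ltn (leq_trans hi) // leq_pmulr.
by rewrite subr0.
Qed.
Arguments log_rel_euler N : clear implicits.

Lemma log_relX N (A T : {poly int}) k : log_rel N A T -> log_rel N (A ^+ k) (T *+ k).
Proof.
move=> h; elim: k => [|k IH].
  by move=> i _; rewrite expr0 mulr0n -[in X in X^`()]polyC1 derivC !mulr0 oppr0.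
by rewrite exprS mulrS; apply: log_relM.
Qed.

(** Differentiating $PE = 1$ gives $XP'E = PET$ modulo the truncation; multiplying by $P$ cancels
    $E$. *)
Lemma pk_poly_lambert k N : 'X * (pk_poly k N)^`() == pk_poly k N * (lambert N *+ k) %[trunc N].
Proof.
set P := pk_poly k N; set E := euler_poly N ^+ k; set T := lambert N *+ k.
have hE : log_rel N E T by apply/log_relX/log_rel_euler.
have hPE : P * E == 1 %[trunc N] by apply: pk_poly_euler.
have hd : 'X * (P * E)^`() == 0 %[trunc N].
  move=> i hi; rewrite coef0 coefXM; case: i hi => //= i hi.
  by rewrite coef_deriv (hPE i.+1 hi) coef1 mul0rn.
have h1 : ('X * P^`()) * E == P * E * T %[trunc N].
  move=> i hi; have := hd i hi; rewrite derivM mulrDr coefD.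
  have -> : 'X * (P * E^`()) = P * ('X * E^`()) by ring.
  by rewrite (eqXMl P hE) // mulrN coefN coef0 => /eqP; rewrite subr_eq0 -!mulrA => /eqP.
have h2 : ('X * P^`()) * E * P == 'X * P^`() %[trunc N].
  have -> : 'X * P^`() * E * P = 'X * P^`() * (P * E) by ring.
  by apply: eqX_trans (eqXMl _ hPE) _; rewrite mulr1.
apply: eqX_trans (eqX_sym h2) _; apply: eqX_trans (eqXMr _ h1) _.
have -> : P * E * T * P = P * T * (P * E) by ring.
by apply: eqX_trans (eqXMl _ hPE) _; rewrite mulr1.
Qed.
Arguments pk_poly_lambert k N : clear implicits.

(** This is $n\,p_k(n) = k\sum_m \sigma(m)\,p_k(n-m)$, with the divisor sum left as a double sum to
    match [pairs]. *)
Lemma pk_recurrence k N n : (n <= N)%N ->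
  (n * pk k n = k * \sum_(d < N) \sum_(e < N)
    (if d.+1 * e.+1 <= n then e.+1 * pk k (n - d.+1 * e.+1) else 0))%N.
Proof.
move=> hn; apply/eqP; rewrite -(eqr_nat int) !natrM.
have h : (n < N.+1)%N by [].
have := pk_poly_lambert k N n h.
have -> : ('X * (pk_poly k N)^`())`_n = n%:R * (pk k n)%:R.
  rewrite coefXM; case: {h} n hn => [|n] hn /=; first by rewrite mul0r.
  by rewrite coef_deriv coef_pk_poly // mulr_natl.
move=> ->; have -> : pk_poly k N * (lambert N *+ k) = (pk_poly k N * lambert N) *+ k.
  by rewrite mulrnAr.
rewrite coefMn [eqbRHS]mulr_natl exchange_big; apply/eqP; congr (_ *+ _).
rewrite /lambert mulr_sumr coef_sum natr_sum.
apply: eq_bigr => e _; rewrite mulr_sumr coef_sum natr_sum; apply: eq_bigr => d _.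
rewrite -scalerAr coefZ coefMXn ltnNge; case: leqP => hde /=; first by rewrite mulr0.
by rewrite coef_pk_poly ?natrM // (leq_trans (leq_subr _ _)).
Qed.

(** * Convolution of log-concave sequences *)

(** Cauchy-Binet: after symmetrising in $(s, t)$, twice the right side is a sum of products of two
    minors, all nonnegative. Only the columns 0 and 1 are kept. *)
Lemma sum_antisym_ge (R : realDomainType) n (u v x y : nat -> R) :
  (forall s t, (s < t < n)%N -> 0 <= u s * v t - u t * v s) ->
  (forall s t, (s < t < n)%N -> 0 <= x s * y t - x t * y s) ->
  (1 < n)%N ->
  (u 0%N * v 1%N - u 1%N * v 0%N) * (x 0%N * y 1%N - x 1%N * y 0%N) <=
  (\sum_(s < n) u s * x s) * (\sum_(t < n) v t * y t)
  - (\sum_(s < n) u s * y s) * (\sum_(t < n) v t * x t).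
Proof.
move=> huv hxy hn.
pose W s t := (u s * v t - u t * v s) * (x s * y t - x t * y s).
have hW s t : (s < n)%N -> (t < n)%N -> 0 <= W s t.
  move=> hs ht; rewrite /W; case: (ltngtP s t) => [hst|hts|->].
  - by apply: mulr_ge0; [apply: huv | apply: hxy]; rewrite hst.
  - rewrite -[X in X * _]opprB -[X in _ * X]opprB mulrNN.
    by apply: mulr_ge0; [apply: huv | apply: hxy]; rewrite hts.
  - by rewrite subrr mul0r.
have E : (\sum_(s < n) u s * x s) * (\sum_(t < n) v t * y t)
  - (\sum_(s < n) u s * y s) * (\sum_(t < n) v t * x t) =
  \sum_(s < n) \sum_(t < n) u s * v t * (x s * y t - x t * y s).
  rewrite !mulr_suml -sumrB; apply: eq_bigr => s _.
  by rewrite !mulr_sumr -sumrB; apply: eq_bigr => t _; ring.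
have E2 : (\sum_(s < n) \sum_(t < n) u s * v t * (x s * y t - x t * y s)) *+ 2 =
   \sum_(s < n) \sum_(t < n) W s t.
  rewrite mulr2n [X in _ + X]exchange_big -big_split; apply: eq_bigr => s _ /=.
  by rewrite -big_split; apply: eq_bigr => t _ /=; rewrite /W; ring.
rewrite E -(ler_pMn2r (n := 2)) // E2.
pose i0 := Ordinal (ltnW hn); pose i1 := Ordinal hn.
rewrite (bigD1 i0) //= (bigD1 i1) //= (bigD1 i1 (F := fun s : 'I_n => \sum_(t < n) W s t)) //=.
rewrite [\sum_(t < n) W 1%N t](bigD1 i0) //=.
rewrite [leLHS](_ : _ = W 0%N 1%N + W 1%N 0%N); last by rewrite mulr2n /W; ring.
have p1 : 0 <= \sum_(i < n | i != i1) W 0%N i.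
  by apply: sumr_ge0 => i _; apply: hW; rewrite ?ltn_ord // ltnW.
have p2 : 0 <= \sum_(i < n | i != i0) W 1%N i.
  by apply: sumr_ge0 => i _; apply: hW; rewrite ?ltn_ord.
have p3 : 0 <= \sum_(i < n | (i != i0) && (i != i1)) \sum_(t < n) W i t.
  by apply: sumr_ge0 => i _; apply: sumr_ge0 => t _; apply: hW.
by lra.
Qed.

Definition pred_val (R : nmodType) (a : nat -> R) n : R := if n is n'.+1 then a n' else 0.

(* With [a (-1) = 0], log-concavity says that the 2 x 2 minors of the Toeplitz
   matrix [a (i - j)] are nonnegative. *)
Lemma log_concave_minor (R : realDomainType) (a : nat -> R) :
  (forall n, 0 < a n) -> (forall n, a n * a n.+2 <= a n.+1 ^+ 2) ->
  forall i j, (i <= j)%N -> pred_val a i * a j.+1 <= a i * a j.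
Proof.
move=> a0 ha [|i] j /=; first by rewrite mul0r mulr_ge0 // ltW.
elim: j => // j IH; rewrite leq_eqVlt => /orP[/eqP[->]|].
  by rewrite -expr2.
rewrite ltnS => hij; have {}IH := IH hij.
rewrite -(ler_pM2r (a0 j)); apply: le_trans (_ : a i * a j.+1 * a j.+1 <= _).
  by rewrite -!mulrA ler_pM2l // [leLHS]mulrC -expr2.
by rewrite mulrAC [leRHS]mulrAC ler_pM2r.
Qed.

(* Cauchy-Binet for the product of two Toeplitz matrices. *)
Lemma convolution_log_concave (R : realDomainType) (a b c : nat -> R) n :
  (forall n, 0 < a n) -> (forall n, 0 < b n) ->
  (forall n, a n * a n.+2 <= a n.+1 ^+ 2) ->
  (forall n, b n * b n.+2 <= b n.+1 ^+ 2) ->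
  (forall n, c n = \sum_(i < n.+1) a (n - i)%N * b i) ->
  (a n.+1 ^+ 2 - a n * a n.+2) * b 0%N ^+ 2 <= c n.+1 ^+ 2 - c n * c n.+2.
Proof.
move=> a0 b0 ha hb hc.
have ma := log_concave_minor a0 ha; have mb := log_concave_minor b0 hb.
(* The rows are $a_{n+1-s}$ and $a_{n+2-s}$, against $b_s$ and $b_{s-1}$. The zero at index $-1$
   lets all four sums run over the same $n+3$ indices, and the kept product of minors is $(a_{n+1}^2
   - a_n a_{n+2})\, b_0^2$. *)
pose u s := pred_val a (n.+2 - s); pose v t := a (n.+2 - t)%N.
have := @sum_antisym_ge R n.+3 u v b (pred_val b).
have -> : \sum_(s < n.+3) u s * b s = c n.+1.
  rewrite big_ord_recr /= /u subnn mul0r addr0 hc; apply: eq_bigr => i _.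
  by rewrite subSn // -ltnS.
have -> : \sum_(s < n.+3) v s * pred_val b s = c n.+1.
  by rewrite big_ord_recl mulr0 add0r hc; apply: eq_bigr => i _; rewrite /v lift0 subSS.
have -> : \sum_(s < n.+3) v s * b s = c n.+2 by rewrite hc.
have -> : \sum_(s < n.+3) u s * pred_val b s = c n.
  rewrite big_ord_recr /= /u subnn mul0r addr0 big_ord_recl mulr0 add0r hc.
  by apply: eq_bigr => i _; rewrite lift0 subSS subSn // -ltnS.
rewrite /u /v /= !subn0 !subSS !subn0 /= => h.
rewrite !expr2 (le_trans _ (h _ _ _)) //.
- by rewrite mulr0 subr0; lra.
- move=> s t /andP[hst ht]; rewrite subr_ge0 [leLHS]mulrC [leRHS]mulrC.
  have -> : (n.+2 - s = (n.+2 - s).-1.+1)%N by lia.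
  rewrite /= [leLHS]mulrC; apply: ma; lia.
- move=> s [//|t] /andP[hst ht] /=; rewrite subr_ge0 [leLHS]mulrC; apply: mb; lia.
Qed.

(** * Computation of the small cases *)

(* The key [Z] is taken by [int_scope]. *)
Delimit Scope Z_scope with BZ.

Fixpoint zsub (l m : seq Z) : seq Z :=
  match l, m with
  | a :: l', b :: m' => (if b is Z0 then a else Z.sub a b) :: zsub l' m'
  | _, _ => [::]
  end.

Definition mul_one_sub_Xn j (l : seq Z) : seq Z := zsub l (nseq j Z0 ++ l).

(* The tests [Z.eqb x x], here and in [conv_inv], are always true: they force the
   entries, so that call-by-need conversion does not pile up suspended sums. *)
Fixpoint euler_list j (l : seq Z) : seq Z :=
  if j is j'.+1 then
    let l' := mul_one_sub_Xn j l in
    if all (fun x => Z.eqb x x) l' then euler_list j' l' else [::]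
  else l.

(** Zeros of [e] are skipped: by Euler's pentagonal number theorem only about $\sqrt N$ coefficients
    of the Euler product are nonzero. *)
Fixpoint dot (e l : seq Z) (s : Z) : Z :=
  match e, l with
  | x :: e', y :: l' => dot e' l' (if x is Z0 then s else Z.add s (Z.mul x y))
  | _, _ => s
  end.

(** Division by the power series $1 + \sum_i e_i q^{i+1}$. The quotient is accumulated newest
    coefficient first, so that [dot e acc] is the convolution to be subtracted. *)
Fixpoint conv_inv (e p acc : seq Z) : seq Z :=
  if p is a :: p' then
    let v := Z.sub a (dot e acc Z0) in
    if Z.eqb v v then conv_inv e p' (v :: acc) else [::]
  else acc.

Definition next_colour (e p : seq Z) : seq Z := rev (conv_inv e p [::]).

(* The leading 40 bits suffice, since the ratio [b ^ 2 / (a c)] exceeds 1 by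
   much more than [2 ^ (-40)]. *)
Definition concave_at (a b c : Z) : bool :=
  let s := Z.sub (Z.log2 b) 40 in
  if Z.ltb 0 s then
    Z.leb (Z.mul (Z.add (Z.shiftr a s) 1) (Z.add (Z.shiftr c s) 1))
          (Z.mul (Z.shiftr b s) (Z.shiftr b s))
  else Z.ltb (Z.mul a c) (Z.mul b b).

Fixpoint concave_list (l : seq Z) : bool :=
  if l is a :: ((b :: c :: _) as l') then
    if concave_at a b c then concave_list l' else false
  else true.

(** [behead] removes the constant coefficient 1 from [e], and $p_k(0)$ from the tested lists: the
    tests start at index 2, because at index 1 three colours give the equality $1 \cdot 9 = 3 \cdot
    3$. *)
Definition small_check N : bool :=
  let e := behead (euler_list N (Zpos xH :: nseq N Z0)) in
  let p3 := next_colour e (next_colour e (next_colour e (Zpos xH :: nseq N Z0))) in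
  let p4 := next_colour e p3 in
  let p5 := next_colour e p4 in
  [&& concave_list (behead p3), concave_list (behead p4) & concave_list (behead p5)].

Lemma size_zsub l m : (size l <= size m)%N -> size (zsub l m) = size l.
Proof. by elim: l m => [|a l IH] [|b m] //= h; rewrite IH. Qed.

Lemma nth_zsub l m i : (size l <= size m)%N -> (i < size l)%N ->
  nth 0 (zsub l m) i = nth 0 l i - nth 0 m i.
Proof.
elim: l m i => [|a l IH] [|b m] [|i] //= h hi; last exact: IH.
by case: b => [|b|b] //; rewrite subr0.
Qed.

Definition represents N (l : seq Z) (p : {poly int}) :=
  size l = N.+1 /\ forall i, (i <= N)%N -> nth 0 l i = Z_of_int p`_i.

Lemma represents1 N : represents N (Zpos xH :: nseq N Z0) 1.
Proof.
split=> [|[|i] hi] /=; first by rewrite size_nseq.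
  by rewrite coef1.
by rewrite nth_nseq coef1 /= if_same.
Qed.

Lemma represents_mul N l p j :
  represents N l p -> represents N (mul_one_sub_Xn j l) (p * (1 - 'X^j)).
Proof.
move=> [hs hl].
have hle : (size l <= size (nseq j Z0 ++ l))%N by rewrite size_cat leq_addl.
split=> [|i hi]; first by rewrite size_zsub.
rewrite nth_zsub //; last by rewrite hs.
rewrite mulrBr mulr1 coefB coefMXn nth_cat size_nseq rmorphB /= hl //.
case: ltnP => hij; first by rewrite nth_nseq hij.
by rewrite hl // (leq_trans (leq_subr _ _)).
Qed.

Lemma represents_euler N l p j :
  represents N l p -> represents N (euler_list j l) (p * euler_poly j).
Proof.
elim: j l p => [|j IH] l p h; first by rewrite /euler_poly big_ord0 mulr1.
rewrite /= (_ : all _ _ = true); last by apply/allP => x _; exact: Z.eqb_refl.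
have -> : p * euler_poly j.+1 = p * (1 - 'X^(j.+1)) * euler_poly j.
  by rewrite /euler_poly big_ord_recr /= [X in p * X]mulrC mulrA.
exact/IH/represents_mul.
Qed.

Lemma dotE e l s : (size l <= size e)%N ->
  dot e l s = s + \sum_(i < size l) nth 0 e i * nth 0 l i.
Proof.
elim: e l s => [|x e IH] [|y l] s //= h; rewrite ?big_ord0 ?addr0 //.
rewrite IH // big_ord_recl /= addrA; congr (_ + _).
by case: x => [|x|x] //; rewrite mul0r addr0.
Qed.

Lemma conv_invE (e : seq Z) (f g : nat -> Z) N :
  size e = N ->
  (forall n, (n <= N)%N -> f n + \sum_(i < n) nth 0 e i * f (n - i.+1)%N = g n) ->
  forall s m, (m + s <= N.+1)%N ->
  conv_inv e [seq g i | i <- iota m s] (rev (mkseq f m)) = rev (mkseq f (m + s)).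
Proof.
move=> he hf; elim=> [|s IH] m hm /=; first by rewrite addn0.
rewrite Z.eqb_refl dotE ?size_rev ?size_mkseq ?he; last by lia.
rewrite add0r.
have -> : Z.sub (g m) (\sum_(i < m) nth 0 e i * nth 0 (rev (mkseq f m)) i) = f m.
  rewrite -(hf m); last by lia.
  rewrite [in X in Z.sub _ X](eq_bigr (fun i : 'I_m => nth 0 e i * f (m - i.+1)%N)).
    exact: addrK.
  by move=> i _; have hi := ltn_ord i; rewrite nth_rev size_mkseq // nth_mkseq //; lia.
have -> : f m :: rev (mkseq f m) = rev (mkseq f m.+1) by rewrite mkseqS rev_rcons.
by rewrite IH ?addSnnS // -addnS addnS; lia.
Qed.

Definition pk_list k N : seq Z := mkseq (fun n => Z.of_nat (pk k n)) N.+1.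

Lemma pk_list0 N : pk_list 0 N = Zpos xH :: nseq N Z0.
Proof.
apply: (@eq_from_nth _ 0); first by rewrite size_mkseq /= size_nseq.
move=> i; rewrite size_mkseq => hi; rewrite nth_mkseq // pk0.
by case: i hi => //= i hi; rewrite nth_nseq if_same.
Qed.

Lemma next_colourE k N :
  next_colour (behead (euler_list N (Zpos xH :: nseq N Z0))) (pk_list k N) = pk_list k.+1 N.
Proof.
have [hs hE] := represents_euler N (represents1 N); rewrite mul1r in hE.
set e := behead _.
have he : size e = N by rewrite size_behead hs.
rewrite /next_colour /pk_list {1}/mkseq.
rewrite (@conv_invE e (fun n => Z.of_nat (pk k.+1 n)) (fun n => Z.of_nat (pk k n)) N he _ N.+1 0).
- by rewrite revK add0n.
- move=> n hn.
  have := congr1 Z_of_int (pkS_euler k hn).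
  rewrite big_ord_recl subn0 raddfD raddf_sum /= => h.
  have e0 : (euler_poly N)`_0 = 1.
    have := pkS_euler 0 (leq0n N); rewrite big_ord1 /= !pk_at0.
    by rewrite mulr1.
  move: h; rewrite e0 mul1r => h.
  have ZnatE m : Z.of_nat m = Z_of_int (m%:R : int) by rewrite natz.
  rewrite !ZnatE -h; congr (_ + _); apply: eq_bigr => i _.
  rewrite nth_behead hE ?rmorphM ?lift0 ?ZnatE //.
  by apply: leq_trans hn; apply: ltn_ord.
- by rewrite add0n.
Qed.

(** Rounding [a] and [c] up and [b] down to multiples of $2^s$ only strengthens the tested
    inequality. *)
Lemma concave_atP a b c : (0 <= a)%BZ -> (0 <= b)%BZ -> (0 <= c)%BZ ->
  concave_at a b c -> (a * c < b * b)%BZ.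
Proof.
move=> a0 b0 c0; rewrite /concave_at; set s := Z.sub _ _.
case: Z.ltb_spec => hs; last by move/Z.ltb_lt.
move/Z.leb_le; rewrite !Z.shiftr_div_pow2; [|lia..].
have hp : (0 < 2 ^ s)%BZ by apply: Z.pow_pos_nonneg; lia.
set q := (2 ^ s)%BZ in hp *.
have := Z.mul_succ_div_gt a q hp; have := Z.mul_succ_div_gt c q hp.
have := Z.mul_div_le b q hp; have := Z.div_pos a q a0 hp.
have := Z.div_pos b q b0 hp; have := Z.div_pos c q c0 hp.
move: (Z.div a q) (Z.div b q) (Z.div c q) => x y z z0 y0 x0 hb hc ha h.
apply: (Z.lt_le_trans _ ((q * (x + 1)) * (q * (z + 1)))); first nia.
apply: (Z.le_trans _ ((q * y) * (q * y))); last nia.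
have -> : (q * (x + 1) * (q * (z + 1)) = (q * q) * ((x + 1) * (z + 1)))%BZ by lia.
have -> : (q * y * (q * y) = (q * q) * (y * y))%BZ by lia.
by apply: Z.mul_le_mono_nonneg_l => //; nia.
Qed.

Lemma concave_listP l : (forall i, (0 <= nth Z0 l i)%BZ) -> concave_list l ->
  forall i, (i.+2 < size l)%N ->
  (nth Z0 l i * nth Z0 l i.+2 < nth Z0 l i.+1 * nth Z0 l i.+1)%BZ.
Proof.
elim: l => [|a [|b [|c l]] IH] //= h0; case: ifP => // hc hl [|i] hi.
  by apply: concave_atP hc; [exact: (h0 0%N) | exact: (h0 1%N) | exact: (h0 2%N)].
by apply: (IH _ hl i) => // j; exact: (h0 j.+1).
Qed.

Lemma pk_list_concave k N : concave_list (behead (pk_list k N)) ->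
  forall n, (2 <= n < N)%N -> (pk k n.-1 * pk k n.+1 < pk k n * pk k n)%N.
Proof.
move=> h [|[|n]] // /andP[_ hn].
have nthE j : (j < N)%N -> nth Z0 (behead (pk_list k N)) j = Z.of_nat (pk k j.+1).
  by move=> hj; rewrite nth_behead nth_mkseq.
have := @concave_listP _ _ h n.
rewrite size_behead size_mkseq !nthE; [|lia..] => H.
have : (Z.of_nat (pk k n.+1) * Z.of_nat (pk k n.+3) <
        Z.of_nat (pk k n.+2) * Z.of_nat (pk k n.+2))%BZ.
  apply: H => // i; case: (ltnP i N) => hi; first by rewrite nthE //; lia.
  by rewrite nth_default // size_behead size_mkseq.
by rewrite /=; nia.
Qed.

Lemma small_checkP N : small_check N ->
  forall k n, (3 <= k <= 5)%N -> (2 <= n < N)%N ->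
  (pk k n.-1 * pk k n.+1 < pk k n * pk k n)%N.
Proof.
have -> : small_check N = [&& concave_list (behead (pk_list 3 N)),
    concave_list (behead (pk_list 4 N)) & concave_list (behead (pk_list 5 N))].
  by rewrite -!next_colourE pk_list0.
case/and3P=> h3 h4 h5.
by move=> [|[|[|[|[|[|k]]]]]] n // _; apply: pk_list_concave.
Qed.

Local Close Scope ring_scope.

(** * Log-concavity and the main theorem *)

Lemma nsumE M (g : nat -> nat) : nsum M g = \sum_(d < M) g d.+1.
Proof.
rewrite /nsum; elim: M => [|M IH]; first by rewrite big_ord0.
by rewrite List.seq_S List.map_app List.list_sum_app IH big_ord_recr /=; lia.
Qed.

Lemma nprodE M (g : nat -> nat) : nprod M g = \prod_(d < M) g d.+1.
Proof.
have foldE l : List.fold_right Nat.mul 1 (List.map g l) = \prod_(i <- l) g i.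
  by elim: l => [|a l IH] /=; rewrite ?big_nil // big_cons IH.
rewrite /nprod foldE; elim: M => [|M IH]; first by rewrite big_ord0 big_nil.
by rewrite List.seq_S big_cat IH big_ord_recr /= big_seq1.
Qed.

Lemma pk_gt0 k n : 0 < k -> 0 < pk k n.
Proof.
move=> k0; elim: n => [|n IH]; first by rewrite pk_at0.
have h := @pk_recurrence k n.+1 n.+1 (leqnn _).
rewrite -(ltn_pmul2l (ltn0Sn n)) muln0 h muln_gt0 k0 (bigD1 ord0) //= (bigD1 ord0) //=.
by rewrite muln1 /= mul1n subSS subn0 !addn_gt0 IH.
Qed.

Lemma pk_log_concave_large k n : 3 <= k -> 282 * k <= n ->
  pk k n.-1 * pk k n.+1 < pk k n * pk k n.
Proof.
move=> hk hn; apply/ssrnat.ltP; rewrite -subn1.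
apply: (log_concave_of_nat_recurrence k (pk k)); [exact/ssrnat.leP | exact/ssrnat.leP | exact: pk_at0 |].
move=> M j [_ /ssrnat.leP hj]; rewrite !multE nsumE (pk_recurrence k hj); congr (_ * _).
apply: eq_bigr => d _; rewrite nsumE; apply: eq_bigr => e _.
case: Nat.leb_spec => h; first by rewrite ifT //; apply/ssrnat.leP.
by rewrite ifF //; apply/ssrnat.leP; lia.
Qed.

Lemma pk_at1 k : pk k 1 = k.
Proof.
have := @pk_recurrence k 1 1 (leqnn _).
by rewrite !big_ord1 /= !mul1n subnn pk_at0 muln1.
Qed.

Lemma pk_at2 k : 2 * pk k 2 = k * (k + 3).
Proof.
have -> := @pk_recurrence k 2 2 (leqnn _); congr (_ * _).
by rewrite !big_ord_recl !big_ord0 /= !mul1n !muln1 subSS subn0 subnn pk_at0 pk_at1 /bump; lia.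
Qed.

(** $1410 = 282 \cdot 5$, so the analytic bound takes over for each of 3, 4, 5 colours. *)
Lemma small_check_1410 : small_check 1410.
Proof. by vm_compute. Qed.

Lemma pk_log_concave_base k n : 3 <= k <= 5 -> 2 <= n ->
  pk k n.-1 * pk k n.+1 < pk k n * pk k n.
Proof.
move=> hk hn; have [h|h] := ltnP n 1410.
  by apply: small_checkP small_check_1410 _ _ hk _; rewrite hn.
by apply: pk_log_concave_large; lia.
Qed.

(** Strictness at [n] is inherited from [k - 3] colours at the same [n]; the factor with 3 colours
    contributes weak inequalities and $p_3(0) = 1$. *)
Lemma pk_log_concave k n : 3 <= k -> 2 <= n ->
  pk k n.-1 * pk k n.+1 < pk k n * pk k n.
Proof.
elim/ltn_ind: k n => k IH n hk hn.
have [h5|h5] := leqP k 5; first by apply: pk_log_concave_base; rewrite ?hk.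
pose z (l i : nat) : int := (pk l i)%:R%R.
have z0 l : 0 < l -> forall i, (0 < z l i)%R by move=> hl i; rewrite ltr0n pk_gt0.
have lc l : 3 <= l < k -> forall i, (z l i * z l i.+2 <= z l i.+1 ^+ 2)%R.
  move=> /andP[hl hlk] [|i]; rewrite expr2 -!natrM ler_nat.
    (* Index 1 lies outside the induction hypothesis: here the claim is $l(l+3)/2 \le l^2$, true
       exactly from $l = 3$ on among positive $l$. *)
    by rewrite pk_at0 pk_at1; have := pk_at2 l; nia.
  by apply: ltnW; exact: (IH l hlk i.+2).
case: n hn => [|[|n]] // _.
have hk3 : 3 <= k - 3 < k by lia.
have h33 : 3 <= 3 < k by lia.
have hc m : z k m = (\sum_(i < m.+1) z (k - 3)%N (m - i)%N * z 3 i)%R.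
  rewrite /z {1}(_ : k = 3 + (k - 3)); last by lia.
  by rewrite pkD natr_sum; apply: eq_bigr => i _; rewrite natrM mulrC.
have k30 : 0 < k - 3 by lia.
have := convolution_log_concave n.+1 (z0 _ k30) (z0 3 isT) (lc _ hk3) (lc _ h33) hc.
rewrite -(ltr_nat int) !natrM -subr_gt0 -expr2; apply: lt_le_trans.
rewrite mulr_gt0 ?exprn_gt0 ?z0 // subr_gt0 expr2 -!natrM ltr_nat.
by apply: (IH _ _ n.+2); lia.
Qed.

Lemma sum_nth (r : nat) (a : r.-tuple nat) m : m <= r ->
  \sum_(j < r | j < m) tnth a j = nsum m (fun j => nth 0 a j.-1).
Proof.
move=> hm; rewrite nsumE (big_ord_widen r (fun j => nth 0 a j) hm).
by apply: eq_bigr => j _; rewrite (tnth_nth 0).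
Qed.

Lemma sum_nth_all (r : nat) (a : r.-tuple nat) :
  \sum_(j < r) tnth a j = nsum r (fun j => nth 0 a j.-1).
Proof. by rewrite nsumE; apply: eq_bigr => j _; rewrite (tnth_nth 0). Qed.

Lemma pk_tupleE k (r : nat) (a : r.-tuple nat) :
  pk_tuple k a = nprod r (fun j => pk k (nth 0 a j.-1)).
Proof. by rewrite nprodE; apply: eq_bigr => j _; rewrite (tnth_nth 0). Qed.

Theorem theorem1p3 (n r : nat) (a b : r.-tuple nat)
  (ha : is_partition n a) (hb : is_partition n b)
  (hba : strictly_majorizes b a) (k : nat) (hk : 3 <= k) :
  pk_tuple k b > pk_tuple k a.
Proof.
have [a1 _ asum] := ha; have [b1 bmon bsum] := hb; have [hmaj hne] := hba.
have nth_tnth (c : r.-tuple nat) (j : nat) (hj : j < r) : nth 0 c j = tnth c (Ordinal hj).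
  by rewrite (tnth_nth 0).
rewrite !pk_tupleE; apply/ssrnat.ltP/nprod_lt_of_majorizes.
- by move=> j; apply/ssrnat.ltP; apply: pk_gt0; lia.
- move=> j /ssrnat.leP hj; apply/ssrnat.ltP; rewrite !multE minusE subn1.
  exact: pk_log_concave.
- move=> [|j] [/ssrnat.leP h1 /ssrnat.leP h2] //; apply/ssrnat.leP.
  by rewrite /= (nth_tnth _ _ h2) a1.
- move=> [|j] [/ssrnat.leP h1 /ssrnat.leP h2] //; apply/ssrnat.leP.
  by rewrite /= (nth_tnth _ _ h2) b1.
- move=> [|j] [/ssrnat.leP h1 /ssrnat.ltP h2] //; apply/ssrnat.leP => /=.
  by rewrite (nth_tnth _ _ h2) (nth_tnth _ _ (ltnW h2)) bmon.
- move=> m [/ssrnat.leP h1 /ssrnat.ltP h2]; apply/ssrnat.leP.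
  rewrite -!sum_nth ?(ltnW h2) //; apply: hmaj; lia.
- by rewrite -!sum_nth_all asum bsum.
have /existsP[j hj] : [exists j : 'I_r, tnth a j != tnth b j].
  apply: contraT; rewrite negb_exists => /forallP h; case: hne.
  by apply: eq_from_tnth => j; apply/eqP; have := h j; rewrite negbK.
exists j.+1; split; first by have := ltn_ord j; lia.
by apply/eqP; rewrite /= -!tnth_nth.
Qed.
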